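(* Let $G$ be a finitely presented group that fits into a short exact sequence of groups $$1\to N\to G\to Q\to 1$$ with $Q$ finitely generated abelian and $N$ finitely presented. Let $(f,g)$ be an area-radius pair for $G$ with $f(n)\geq n$ for all $n$. Then there is a constant $A>1$ such that the Dehn function $\delta_N$ of $N$ is bounded above by the function $n\mapsto A^{g(n)}f(n)$, up to asymptotic equivalence, that is, $\delta_N(n)\preccurlyeq A^{g(n)}f(n)$.
   Context: Let $H$ be a group with finite presentation $\mathcal{P}=\langle X\mid R\rangle$ and let $F_X$ be the free group on $X$. A word $w$ in $X^{\pm 1}$ is null-homotopic if it represents the trivial element of $H$. Its area $\mathrm{Area}_{\mathcal{P}}(w)$ is the minimal $k$ such that in $F_X$ one has $w=\prod_{i=1}^k u_i r_i u_i^{-1}$ with $r_i\in R^{\pm1}$ and $u_i\in F_X$; equivalently, it is the minimal number of 2-cells of a van Kampen diagram over $\mathcal{P}$ with boundary word $w$. The Dehn function of $H$ with respect to $\mathcal{P}$ is $\delta_{H,\mathcal{P}}(n):=\max\{\mathrm{Area}_{\mathcal{P}}(w)\mid w \text{ null-homotopic},\ \ell(w)\leq n\}$, where $\ell(w)$ is the length of $w$. For functions $f_1,f_2$ write $f_1\preccurlyeq f_2$ ($f_2$ asymptotically bounds $f_1$) if there is a constant $C\geq 1$ (taken to be an integer for functions on $\mathbb{N}$) with $f_1(n)\leq Cf_2(Cn+C)+Cn+C$ for all $n$, and $f_1\asymp f_2$ (asymptotically equivalent) if $f_1\preccurlyeq f_2\preccurlyeq f_1$. Up to $\asymp$ the Dehn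 function does not depend on the choice of finite presentation, and one writes $\delta_H$ for it. The area of a van Kampen diagram is its number of 2-cells. The radius of a van Kampen diagram is the maximal (combinatorial, edge-path) distance of one of its vertices from its boundary. A pair of functions $(f,g)$ with $f,g:\mathbb{N}\to\mathbb{R}$ is an area-radius pair for a finite presentation of $G$ if for every $n$ and every null-homotopic word $w$ of length $\ell(w)\leq n$ there is a van Kampen diagram for $w$ over this presentation that has both area at most $f(n)$ and radius at most $g(n)$. An area-radius pair for $G$ is an area-radius pair for some finite presentation of $G$. *)

(* Defs.v *)
From HB Require Import structures.
From mathcomp Require Import all_boot all_order all_algebra all_fingroup.
From mathcomp Require Import boolp reals exp.

Set Implicit Arguments.
Unset Strict Implicit.
Unset Printing Implicit Defensive.

Import Order.TTheory GRing.Theory Num.Theory.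

(* The pair (x, b) is the letter x if b = false, and x^-1 if b = true. *)
Definition letter (X : Type) : Type := (X * bool)%type.
Definition word (X : Type) : Type := seq (letter X).

Definition inv_letter (X : Type) (a : letter X) : letter X := (a.1, ~~ a.2).
Definition inv_word (X : Type) (w : word X) : word X :=
  rev (map (@inv_letter X) w).

Definition free_reduce (X : eqType) (w : word X) : word X :=
  foldr (fun a s => if s is b :: s' then
                      if b == inv_letter a then s' else a :: s
                    else [:: a]) [::] w.

(* Equality in the free group F_X: every class of words modulo free reduction
   contains exactly one reduced word. *)
Definition free_eq (X : eqType) (u v : word X) : bool :=
  free_reduce u == free_reduce v.

Definition is_relator (X : eqType) (rels : seq (word X)) (r : word X) : bool :=
  (r \in rels) || (inv_word r \in rels).

(* A pair (u, r) in s stands for the factor u r u^-1. *)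
Definition conj_product (X : eqType) (rels : seq (word X)) (w : word X)
    (k : nat) : Prop :=
  exists s : seq (word X * word X),
    [/\ size s = k,
        all (fun ur => is_relator rels ur.2) s
      & free_eq w (flatten [seq ur.1 ++ ur.2 ++ inv_word ur.1 | ur <- s])].

(* The value 0 given to words that are not null-homotopic is irrelevant. *)
Definition area (X : eqType) (rels : seq (word X)) (w : word X) : nat :=
  if pselect (exists k, `[< conj_product rels w k >]) is left ex
  then ex_minn ex else 0.

Definition word_val (X : Type) (G : groupType) (v : X -> G) (w : word X) : G :=
  (\prod_(a <- w) (if a.2 then (v a.1)^-1 else v a.1))%g.

(* The last two fields say that word_val gen_val induces an isomorphism from
   the quotient of F_gens by the normal closure of the relators to G. *)
Record finite_presentation (G : groupType) := FinitePresentation {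
  gens : finType;
  rels : seq (word gens);
  gen_val : gens -> G;
  gen_val_surj : forall x : G, exists w, word_val gen_val w = x;
  gen_val_ker : forall w : word gens,
    word_val gen_val w = 1%g <-> exists k, conj_product rels w k }.

Definition finitely_presented (G : groupType) : Prop :=
  inhabited (finite_presentation G).

Definition finitely_generated (G : groupType) : Prop :=
  exists (X : finType) (v : X -> G), forall x : G, exists w, word_val v w = x.

Definition null_homotopic (G : groupType) (P : finite_presentation G)
    (w : word (gens P)) : Prop :=
  word_val (@gen_val G P) w = 1%g.

Definition dehn (G : groupType) (P : finite_presentation G) (n : nat) : nat :=
  \max_(w : n.-bseq (gens P * bool)%type | `[< @null_homotopic G P w >])
     area (rels P) w.

(* A finite connected plane graph with at least one edge, as a combinatorial
   map of genus 0 with a distinguished (outer) face. Darts are oriented edges: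
   edge d is d reversed, face d is the dart following d along the boundary of
   the face incident to d, so it starts where d ends. Hence the darts with the
   same source as d form its orbit under d |-> face (edge d), which is
   (edge * face)%g d. Vertices, edges and faces are the orbits of node, edge
   and face; a connected map has genus 0 iff V - E + F = 2. *)
Record plane_map := PlaneMap {
  dart : finType;
  edge : {perm dart};
  face : {perm dart};
  outer : dart;
  edgeK : forall d, edge (edge d) = d;
  edge_neq : forall d, edge d != d;
  map_connected : forall d d' : dart,
    connect (fun x y => (y == edge x) || (y == face x)) d d';
  map_euler :
    (#|porbits (edge * face)%g| + #|porbits face| = #|porbits edge| + 2)%N }.

Section PlaneMap.
Variable M : plane_map.

Definition node : {perm dart M} := (edge M * face M)%g.

Definition vertex (d : dart M) : {set dart M} := porbit node d.

Definition vertex_adj (u v : {set dart M}) : bool :=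
  [exists d, (u == vertex d) && (v == vertex (edge M d))].

Definition boundary_vertices : {set {set dart M}} :=
  vertex @: porbit (face M) (outer M).

(* Least length of an edge path from v to the boundary; as M is connected,
   this is smaller than the number of vertices. *)
Definition boundary_dist (v : {set dart M}) : nat :=
  find (fun k => [exists p : k.-tuple {set dart M},
                    path vertex_adj v p && (last v p \in boundary_vertices)])
       (iota 0 #|porbits node|).

Definition map_radius : nat := \max_(v in porbits node) boundary_dist v.

Definition map_area : nat := #|porbits (face M) :\ porbit (face M) (outer M)|.

Definition face_word (X : Type) (lab : dart M -> letter X) (d : dart M) :
    word X :=
  map lab (traject (face M) d #|porbit (face M) d|).

End PlaneMap.

(* The one-vertex diagram, which bounds the empty word, has no darts. The outer
   face reads w starting from the dart outer; every other face reads an element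
   of R^(+-1) starting from one of its darts. *)
Inductive vk_diagram (X : eqType) (rels : seq (word X)) (w : word X) : Type :=
| VKPoint of w = [::]
| VKMap (M : plane_map) (lab : dart M -> letter X) of
    (forall d, lab (edge M d) = inv_letter (lab d)) &
    face_word lab (outer M) = w &
    (forall d, d \notin porbit (face M) (outer M) ->
       exists2 d', d' \in porbit (face M) d & is_relator rels (face_word lab d')).

Definition vk_area (X : eqType) (rels : seq (word X)) (w : word X)
    (D : vk_diagram rels w) : nat :=
  match D with VKPoint _ => 0 | VKMap M _ _ _ _ => map_area M end.

Definition vk_radius (X : eqType) (rels : seq (word X)) (w : word X)
    (D : vk_diagram rels w) : nat :=
  match D with VKPoint _ => 0 | VKMap M _ _ _ _ => map_radius M end.

Local Open Scope ring_scope.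

Definition area_radius_pair_for (K : realType) (G : groupType)
    (P : finite_presentation G) (f g : nat -> K) : Prop :=
  forall (n : nat) (w : word (gens P)),
    null_homotopic w -> (size w <= n)%N ->
    exists D : vk_diagram (rels P) w,
      (vk_area D)%:R <= f n /\ (vk_radius D)%:R <= g n.

Definition area_radius_pair (K : realType) (G : groupType) (f g : nat -> K) :
    Prop :=
  exists P : finite_presentation G, area_radius_pair_for P f g.

Definition asymp_le (K : realType) (f1 f2 : nat -> K) : Prop :=
  exists2 C : nat, (1 <= C)%N &
    forall n : nat,
      f1 n <= C%:R * f2 (C * n + C)%N + C%:R * n%:R + C%:R.

Definition short_exact (N G Q : groupType) (i : {multiplicative N -> G})
    (p : {multiplicative G -> Q}) : Prop :=
  [/\ injective i,
      forall x : G, p x = 1%g <-> exists y : N, i y = x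
    & forall z : Q, exists x : G, p x = z].

(* Main.v *)
(** A van Kampen diagram D for w over the presentation of G has a spanning tree
    of its 1-skeleton such that the edges outside it form a spanning tree of the
    dual graph. Peeling off faces along the dual tree writes w in the free group
    as a product of Area(D) conjugates u r u^-1 of relators, where u is a tree
    path to a vertex of D. If w represents an element of N read off from
    generators of N, the boundary of D maps to a bounded neighbourhood of 1 in
    Q, so each u has image of length at most g(n) + O(1) in Q.

    A section s of G -> Q gives a crossed map Phi that rewrites a word of G read
    from the point q of Q as a word of N, the letter x becoming
    s(q) x s(qx)^-1. Being crossed, Phi turns u r u^-1 into a conjugate of
    Phi(q, r), q the image of u, so it remains to see that the N-area of
    Phi(q, r) is at most exponential in |q|. This is done one generator x of G
    at a time, for the subgroups N <= H <= <H, x>: with s(q x^a) = s(q) x^a, the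
    value Phi(q x^a, y) is Phi(q, x^a y x^-a), and lifting conjugation by x to an
    endomorphism of the free group multiplies the number of relators needed by
    a constant, while moving their positions in the abelian group Q only by a
    constant. *)

Require Import Defs.
From HB Require Import structures.
From mathcomp Require Import all_boot all_order all_algebra all_fingroup.
From mathcomp Require Import boolp reals exp.

Set Implicit Arguments.
Unset Strict Implicit.
Unset Printing Implicit Defensive.

Import Order.TTheory GRing.Theory Num.Theory.
Local Open Scope group_scope.

(** * Free groups *)

Section FreeReduction.
Variable X : eqType.
Implicit Types (a b : letter X) (u v w : word X).

Definition reduce_cons a w : word X :=
  if w is b :: w' then if b == inv_letter a then w' else a :: w else [:: a].

Definition reduced w := sorted (fun a b => b != inv_letter a) w.

Lemma free_reduceE w : free_reduce w = foldr reduce_cons [::] w.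
Proof. by []. Qed.

Lemma inv_letterK : involutive (@inv_letter X).
Proof. by case=> x b; rewrite /inv_letter /= negbK. Qed.

Lemma inv_wordK : involutive (@inv_word X).
Proof.
by move=> w; rewrite /inv_word map_rev revK -map_comp (eq_map inv_letterK) map_id.
Qed.

Lemma inv_word_cons a w : inv_word (a :: w) = inv_word w ++ [:: inv_letter a].
Proof. by rewrite /inv_word /= rev_cons cats1. Qed.

Lemma size_inv_word w : size (inv_word w) = size w.
Proof. by rewrite size_rev size_map. Qed.

Lemma reduced_reduce_cons a w : reduced w -> reduced (reduce_cons a w).
Proof.
case: w => [|b w] //= rw; case: (altP eqP) => [_|ne]; first exact: path_sorted rw.
by rewrite /reduced /= ne.
Qed.

Lemma reduced_foldr u w : reduced w -> reduced (foldr reduce_cons w u).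
Proof. by move=> rw; elim: u => //= a u; apply: reduced_reduce_cons. Qed.

Lemma free_reduce_id w : reduced w -> free_reduce w = w.
Proof.
elim: w => [|a w IHw] // rw; rewrite free_reduceE /= -free_reduceE.
rewrite IHw; last exact: path_sorted rw.
by case: w rw {IHw} => [|b w] //= /andP[ne _] /=; rewrite ifN.
Qed.

Lemma reduce_consK a w : reduced w ->
  reduce_cons a (reduce_cons (inv_letter a) w) = w.
Proof.
case: w => [|b w] /= rw; first by rewrite eqxx.
rewrite inv_letterK; case: (altP (b =P a)) => [eba|_] /=; last by rewrite eqxx.
by subst b; case: w rw => [|c w] //= /andP[/negPf->].
Qed.

(** On reduced words the letters act through [reduce_cons] by permutations, inverse letters acting
    inversely ([reduce_consK]). Hence a word and its free reduction act alike; this takes the place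
    of a confluence argument. *)
Lemma foldr_reduce_cons_free_reduce u w : reduced w ->
  foldr reduce_cons w (free_reduce u) = foldr reduce_cons w u.
Proof.
move=> rw; elim: u => // a u IHu.
rewrite free_reduceE /= -free_reduceE -IHu.
case: (free_reduce u) => [|b s] //=; case: eqP => [->|//].
by rewrite reduce_consK // reduced_foldr.
Qed.

End FreeReduction.

(** Taking reduced words as elements makes equality in the free group Leibniz equality, so no
    quotient is formed. *)
Record free_group (X : finType) := FreeGroup {
  free_word :> word X;
  free_wordP : free_reduce free_word == free_word }.

Section FreeGroup.
Variable X : finType.

HB.instance Definition _ := [isSub for @free_word X].
HB.instance Definition _ := [Choice of free_group X by <:].

Lemma free_reduce_idem (w : word X) :
  free_reduce (free_reduce w) == free_reduce w.
Proof. by rewrite free_reduce_id // reduced_foldr. Qed.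

Definition free_of_word (w : word X) : free_group X :=
  FreeGroup (free_reduce_idem w).

Lemma free_of_wordP (u v : word X) :
  reflect (free_of_word u = free_of_word v) (free_eq u v).
Proof.
by apply: (iffP eqP) => [e|/(congr1 val) //]; apply: val_inj.
Qed.

Lemma free_wordK (x : free_group X) : free_of_word x = x.
Proof. by apply: val_inj; rewrite /= (eqP (free_wordP x)). Qed.

Definition free_mul (x y : free_group X) := free_of_word (free_word x ++ free_word y).
Definition free_inv (x : free_group X) := free_of_word (inv_word x).

Lemma free_mulE (u v : word X) :
  free_mul (free_of_word u) (free_of_word v) = free_of_word (u ++ v).
Proof.
apply: val_inj; rewrite /= !free_reduceE !foldr_cat -!free_reduceE.
by rewrite (eqP (free_reduce_idem v)) foldr_reduce_cons_free_reduce ?reduced_foldr.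
Qed.

Lemma free_mulA : associative free_mul.
Proof.
move=> x y z; rewrite -[x]free_wordK -[y]free_wordK -[z]free_wordK.
by rewrite !free_mulE catA.
Qed.

Lemma free_mul1g : left_id (free_of_word [::]) free_mul.
Proof. by move=> x; rewrite -{1}[x]free_wordK free_mulE /= free_wordK. Qed.

Lemma free_mulg1 : right_id (free_of_word [::]) free_mul.
Proof. by move=> x; rewrite -{1}[x]free_wordK free_mulE cats0 free_wordK. Qed.

Lemma free_of_word_catV (w : word X) :
  free_of_word (w ++ inv_word w) = free_of_word [::].
Proof.
elim: w => // a w IHw.
rewrite inv_word_cons cat_cons catA -cat1s -free_mulE -free_mulE IHw free_mul1g.
rewrite free_mulE; apply: val_inj; rewrite /= eqxx //.
Qed.

Lemma free_mulgV : right_inverse (free_of_word [::]) free_inv free_mul.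
Proof.
by move=> x; rewrite /free_inv -{1}[x]free_wordK free_mulE free_of_word_catV.
Qed.

Lemma free_mulVg : left_inverse (free_of_word [::]) free_inv free_mul.
Proof.
move=> x; rewrite /free_inv -{2}[x]free_wordK free_mulE.
by rewrite -{2}[x : word X]inv_wordK free_of_word_catV.
Qed.

HB.instance Definition _ := isGroup.Build (free_group X)
  free_mulA free_mul1g free_mulg1 free_mulVg free_mulgV.

Lemma free_of_word_nil : free_of_word [::] = 1. Proof. by []. Qed.

Lemma free_of_word_cat (u v : word X) :
  free_of_word (u ++ v) = free_of_word u * free_of_word v.
Proof. by rewrite -free_mulE. Qed.

Lemma free_of_word_inv (u : word X) :
  free_of_word (inv_word u) = (free_of_word u)^-1.
Proof.
apply: (mulgI (free_of_word u)); rewrite mulgV -free_of_word_cat.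
exact: free_of_word_catV.
Qed.

Definition free_gen (x : X) : free_group X := free_of_word [:: (x, false)].

Lemma free_of_letter a :
  free_of_word [:: a] = if a.2 then (free_gen a.1)^-1 else free_gen a.1.
Proof. by case: a => x [] //=; rewrite -free_of_word_inv. Qed.

Lemma free_of_word_cons a w :
  free_of_word (a :: w) =
    (if a.2 then (free_gen a.1)^-1 else free_gen a.1) * free_of_word w.
Proof. by rewrite -free_of_letter -free_of_word_cat. Qed.

Lemma free_ind (P : free_group X -> Prop) :
  P 1 -> (forall z x, P x -> P (free_gen z * x)) ->
  (forall z x, P x -> P ((free_gen z)^-1 * x)) -> forall x, P x.
Proof.
move=> P1 Pg PV x; rewrite -[x]free_wordK; elim: (x : word X) => // a w IHw.
by rewrite free_of_word_cons; case: a.2; [apply: PV|apply: Pg].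
Qed.

End FreeGroup.

Section WordValues.
Variables (X : eqType) (G : groupType) (v : X -> G).

Lemma word_val_nil : word_val v [::] = 1.
Proof. exact: big_nil. Qed.

Lemma word_val_cons a w :
  word_val v (a :: w) = (if a.2 then (v a.1)^-1 else v a.1) * word_val v w.
Proof. exact: big_cons. Qed.

Lemma word_val_cat u w : word_val v (u ++ w) = word_val v u * word_val v w.
Proof. exact: big_cat. Qed.

Lemma word_val_free_reduce w : word_val v (free_reduce w) = word_val v w.
Proof.
elim: w => // a w IHw; rewrite free_reduceE /= -free_reduceE word_val_cons -IHw.
case: (free_reduce w) => [|b s] /=; first by rewrite word_val_cons.
case: eqP => [->|_]; rewrite !word_val_cons //= mulgA.
by case: a => x [] /=; rewrite ?mulVg ?mulgV mul1g.
Qed.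

End WordValues.

Section Universal.
Variables (X : finType) (G : groupType) (v : X -> G).

Definition free_lift (x : free_group X) : G := word_val v x.

Lemma free_lift_word w : free_lift (free_of_word w) = word_val v w.
Proof. exact: word_val_free_reduce. Qed.

Lemma free_lift_mul : {morph free_lift : x y / x * y}.
Proof.
move=> x y; rewrite -[x]free_wordK -[y]free_wordK -free_of_word_cat.
by rewrite !free_lift_word word_val_cat.
Qed.

Lemma free_lift1 : free_lift 1 = 1.
Proof. by rewrite -free_of_word_nil free_lift_word word_val_nil. Qed.

HB.instance Definition _ :=
  isUMagmaMorphism.Build (free_group X) G free_lift (free_lift1, free_lift_mul).

Lemma free_lift_gen x : free_lift (free_gen x) = v x.
Proof. by rewrite free_lift_word word_val_cons word_val_nil mulg1. Qed.

End Universal.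

(** * Products of boundedly many conjugates *)

(* At most k factors: nprod1 allows every k. *)
Inductive nprod (T : groupType) (S : T -> Prop) : nat -> T -> Prop :=
| nprod1 k : nprod S k 1
| nprod_mul k s x : S s -> nprod S k x -> nprod S k.+1 (s * x).

Section BoundedProducts.
Variables (T : groupType) (S : T -> Prop).

Lemma nprod_leq k l x : (k <= l)%N -> nprod S k x -> nprod S l x.
Proof.
move=> lekl Sx; elim: Sx l lekl => {k x} [k l _|k s x Ss _ IHx [|l] //].
  exact: nprod1.
by rewrite ltnS => /IHx; apply: nprod_mul.
Qed.

Lemma nprodM k l x y : nprod S k x -> nprod S l y -> nprod S (k + l) (x * y).
Proof.
move=> Sx Sy; elim: Sx => {k x} [k|k s x Ss _ IHx].
  by rewrite mul1g; apply: nprod_leq Sy; apply: leq_addl.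
by rewrite -mulgA addSn; apply: nprod_mul.
Qed.

Lemma nprod_gen s : S s -> nprod S 1 s.
Proof. by move=> Ss; rewrite -[s]mulg1; apply: nprod_mul => //; apply: nprod1. Qed.

Lemma nprodV k x : (forall s, S s -> S s^-1) -> nprod S k x -> nprod S k x^-1.
Proof.
move=> SV; elim=> {k x} [k|k s x Ss _ IHx]; first by rewrite invg1; apply: nprod1.
by rewrite invgM -addn1; apply: nprodM => //; apply/nprod_gen/SV.
Qed.

Lemma nprod_prod (I : eqType) (r : seq I) (K : I -> nat) (F : I -> T) :
  {in r, forall i, nprod S (K i) (F i)} ->
  nprod S (\sum_(i <- r) K i) (\prod_(i <- r) F i).
Proof.
elim: r => [|i r IHr] Fr; first by rewrite !big_nil; apply: nprod1.
rewrite !big_cons; apply: nprodM; first by apply/Fr/mem_head.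
by apply: IHr => j rj; apply: Fr; rewrite inE rj orbT.
Qed.

Lemma nprod_ker (G : groupType) (v : UMagmaMorphism.type T G) k x :
  (forall s, S s -> v s = 1) -> nprod S k x -> v x = 1.
Proof.
move=> vS; elim=> {k x} [k|k s x /vS vs _ vx]; first exact: gmulf1.
by rewrite gmulfM vs vx mul1g.
Qed.

End BoundedProducts.

Section BoundedProductMaps.
Variables (T : groupType) (S : T -> Prop).

(** Multiplicativity is asked for only at a left factor in [S]. Crossed maps satisfy this when the
    elements of [S] have trivial image in [Q]. *)
Lemma nprod_map (T' : groupType) (S' : T' -> Prop) (f : T -> T') C k x :
  f 1 = 1 -> (forall s y, S s -> f (s * y) = f s * f y) ->
  (forall s, S s -> nprod S' C (f s)) ->
  nprod S k x -> nprod S' (k * C) (f x).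
Proof.
move=> f1 fM fS; elim=> {k x} [k|k s x Ss _ IHx]; first by rewrite f1; apply: nprod1.
by rewrite fM // mulSn; apply: nprodM => //; apply: fS.
Qed.

Lemma nprod_morph (T' : groupType) (S' : T' -> Prop)
    (f : UMagmaMorphism.type T T') C k x :
  (forall s, S s -> nprod S' C (f s)) ->
  nprod S k x -> nprod S' (k * C) (f x).
Proof. by apply: nprod_map => [|s y _]; [apply: gmulf1|apply: gmulfM]. Qed.

Lemma nprod_conj (S' : T -> Prop) t k x :
  (forall s, S s -> S' (t * s * t^-1)) -> nprod S k x -> nprod S' k (t * x * t^-1).
Proof.
move=> SS'; elim=> {k x} [k|k s x Ss _ IHx].
  by rewrite mulg1 mulgV; apply: nprod1.
have -> : t * (s * x) * t^-1 = (t * s * t^-1) * (t * x * t^-1).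
  by rewrite !mulgA mulgVK.
by apply: nprod_mul => //; apply: SS'.
Qed.

Lemma nprod_sub (S' : T -> Prop) k x :
  (forall s, S s -> S' s) -> nprod S k x -> nprod S' k x.
Proof.
by move=> SS'; elim=> {k x} [k|k s x /SS' Ss _]; [apply: nprod1|apply: nprod_mul].
Qed.

End BoundedProductMaps.

Section RelatorConjugates.
Variables (X : finType) (rels : seq (word X)).

(** [U] restricts the conjugators: it carries the distance information next to the count of
    factors. *)
Definition rel_conj (U : free_group X -> Prop) (x : free_group X) : Prop :=
  exists u r, [/\ U u, is_relator rels r & x = u * free_of_word r * u^-1].

Definition any_conj : free_group X -> Prop := rel_conj (fun=> True).

Lemma is_relatorV r : is_relator rels r -> is_relator rels (inv_word r).
Proof. by rewrite /is_relator inv_wordK orbC. Qed.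

Lemma rel_conjV U x : rel_conj U x -> rel_conj U x^-1.
Proof.
case=> u [r [Uu Rr ->]]; exists u, (inv_word r); split=> //.
  exact: is_relatorV.
by rewrite free_of_word_inv !invgM invgK mulgA.
Qed.

Lemma rel_conj_sub (U V : free_group X -> Prop) x :
  (forall u, U u -> V u) -> rel_conj U x -> rel_conj V x.
Proof. by move=> UV [u [r [/UV Vu Rr ->]]]; exists u, r. Qed.

Lemma rel_conjJ (U V : free_group X -> Prop) t x :
  (forall u, U u -> V (t * u)) -> rel_conj U x -> rel_conj V (t * x * t^-1).
Proof.
move=> UV [u [r [/UV Vu Rr ->]]]; exists (t * u), r; split=> //.
by rewrite invgM !mulgA.
Qed.

Lemma nprod_any_conjJ t k x :
  nprod any_conj k x -> nprod any_conj k (t * x * t^-1).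
Proof. by apply: nprod_conj => s; apply: rel_conjJ. Qed.

Lemma is_relator_ind (P : free_group X -> Prop) :
  (forall x, P x -> P x^-1) ->
  (forall r, r \in rels -> P (free_of_word r)) ->
  forall r, is_relator rels r -> P (free_of_word r).
Proof.
move=> PV PR r /orP[/PR //|/PR/PV].
by rewrite free_of_word_inv invgK.
Qed.

Lemma conj_product_nprod w k :
  conj_product rels w k -> nprod any_conj k (free_of_word w).
Proof.
case=> s [<- {k} Rs /free_of_wordP->].
elim: s Rs => [|[u r] s IHs] /=; first by move=> _; apply: nprod1.
case/andP=> Rr /IHs Ps; rewrite !free_of_word_cat free_of_word_inv mulgA.
by apply: nprod_mul => //; exists (free_of_word u), r; split.
Qed.

Lemma nprod_conj_product w k : nprod any_conj k (free_of_word w) ->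
  exists2 l, (l <= k)%N & conj_product rels w l.
Proof.
move defx: (free_of_word w) => x Sx.
elim: Sx w defx => {k x} [k|k _ x [u [r [_ Rr ->]]] _ IHx] w defw.
  by exists 0%N => //; exists [::]; split=> //; apply/free_of_wordP.
have [l lek [s [size_s Rs /free_of_wordP ds]]] := IHx x (free_wordK x).
exists l.+1 => //; exists ((free_word u, r) :: s); split=> /=; rewrite ?size_s ?Rr //.
apply/free_of_wordP; rewrite !free_of_word_cat -ds free_of_word_inv !free_wordK.
by rewrite defw !mulgA.
Qed.

Lemma area_leq w k : nprod any_conj k (free_of_word w) -> (area rels w <= k)%N.
Proof.
case/nprod_conj_product=> l lelk Pl; rewrite /area.
case: pselect => // ex; case: ex_minnP => m _ min_m.
by apply: leq_trans lelk; apply: min_m; apply/asboolP.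
Qed.

End RelatorConjugates.

Section Presentation.
Variables (G : groupType) (P : finite_presentation G).

Definition pres_val : free_group (gens P) -> G := free_lift (@gen_val G P).

HB.instance Definition _ := UMagmaMorphism.on pres_val.

Lemma pres_val_word w : pres_val (free_of_word w) = word_val (@gen_val G P) w.
Proof. exact: free_lift_word. Qed.

Lemma pres_val_gen x : pres_val (free_gen x) = gen_val x.
Proof. exact: free_lift_gen. Qed.

Lemma pres_val_surj g : exists x, pres_val x = g.
Proof.
by have [w <-] := gen_val_surj P g; exists (free_of_word w); rewrite pres_val_word.
Qed.

Lemma pres_valP x :
  pres_val x = 1 <-> exists k, nprod (any_conj (rels P)) k x.
Proof.
rewrite -[x]free_wordK pres_val_word; split.
  by case/gen_val_ker=> k /conj_product_nprod; exists k.
by case=> k /nprod_conj_product[l _ Pl]; apply/gen_val_ker; exists l.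
Qed.

Lemma pres_val_relator r : is_relator (rels P) r -> pres_val (free_of_word r) = 1.
Proof.
move=> Rr; apply/pres_valP; exists 1%N; apply: nprod_gen; exists 1, r.
by rewrite invg1 mulg1 mul1g.
Qed.

End Presentation.

(** * Trees and cotrees in plane maps *)

(** After more than [dep x] iterations of [F] the value at [x] is stable, whatever the start
    [v0]. *)
Lemma depth_recursion (I V : Type) (v0 : V) (dep : I -> nat)
    (F : (I -> V) -> I -> V) :
  (forall g h x, (forall y, (dep y < dep x)%N -> g y = h y) -> F g x = F h x) ->
  exists h, forall x, h x = F h x.
Proof.
move=> FP; pose g n := iter n F (fun=> v0).
have gP n : forall m x, (dep x < n)%N -> (dep x < m)%N -> g n x = g m x.
  elim: n => [|n IHn] [|m] x //; rewrite !ltnS => lexn lexm.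
  apply: FP => y ltyx; apply: IHn; exact: leq_trans ltyx _.
exists (fun x => g (dep x).+1 x) => x; apply: FP => y ltyx.
by apply: gP => //; apply: ltnW.
Qed.

Section PermOrbits.
Variables (D : finType) (s : {perm D}).

Lemma porbit_step d : porbit s (s d) = porbit s d.
Proof. by have := porbit_perm s 1 d; rewrite expg1. Qed.

Lemma mem_porbitP d x :
  reflect (exists2 i, (i < #|porbit s d|)%N & x = iter i s d) (x \in porbit s d).
Proof. by rewrite porbit_traject; apply: trajectP. Qed.

(** Orbits are finite cycles, so going back one step is going forward several. *)
Lemma perm_invariant_iff (U : D -> Prop) :
  (forall d, U d -> U (s d)) -> forall d, U (s d) <-> U d.
Proof.
move=> Us d; split=> [Usd|]; last exact: Us.
have: d \in porbit s (s d) by rewrite porbit_step porbit_id.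
by case/mem_porbitP=> i _ ->; elim: i => //= i; apply: Us.
Qed.

End PermOrbits.

(* C picks one parent dart in every orbit other than the root's: a spanning
   tree of the graph whose vertices are the s-orbits and whose edges are the
   pairs {d, e d} with ok d. *)
Record spanning_tree (D : finType) (e s : {perm D}) (ok : pred D) (r : D)
    (C : {set D}) (dep : D -> nat) : Prop := SpanningTree {
  tree_dep : forall d, dep (s d) = dep d;
  tree_ok : {in C, forall x, ok x};
  tree_lt : {in C, forall x, (dep (e x) < dep x)%N};
  tree_uniq : {in C &, forall x y, y \in porbit s x -> x = y};
  tree_root : {in C, forall x, x \notin porbit s r};
  tree_cover : forall d, d \notin porbit s r -> exists2 x, x \in C & x \in porbit s d }.

Section SpanningTree.
Variables (D : finType) (e s : {perm D}) (r : D).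
Hypothesis eK : forall d, e (e d) = d.

(** Breadth-first search: [B n] holds the darts whose orbit is at distance at most [n] from that of
    [r], [dep] is the first layer containing a dart, and each further orbit selects a dart leading
    to an earlier layer. *)
Lemma spanning_tree_exists (ok : pred D) :
  (forall d, ok (e d) = ok d) ->
  (forall U : D -> Prop, U r -> (forall d, U d -> U (s d)) ->
     (forall d, ok d -> U d -> U (e d)) -> forall d, U d) ->
  exists C dep, spanning_tree e s ok r C dep.
Proof.
move=> okE conn.
pose layer (A : {set D}) :=
  A :|: [set d | [exists x in porbit s d, ok x && (e x \in A)]].
pose B n := iter n layer (porbit s r).
have Bs n d : (s d \in B n) = (d \in B n).
  elim: n d => [|n IHn] d /=; last by rewrite !inE IHn porbit_step.
  by rewrite -!eq_porbit_mem porbit_step.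
have exB d : exists n, d \in B n.
  move: d; apply: conn => [|d [n Bd]|d okd [n Bd]].
  - by exists 0%N; apply: porbit_id.
  - by exists n; rewrite Bs.
  exists n.+1; rewrite !inE; apply/orP; right.
  by apply/existsP; exists (e d); rewrite porbit_id okE okd eK.
pose dep d := ex_minn (exB d).
have depP d n : d \in B n -> (dep d <= n)%N.
  by rewrite /dep; case: ex_minnP => m _; apply.
have dep_mem d : d \in B (dep d) by rewrite /dep; case: ex_minnP.
have deps d : dep (s d) = dep d.
  by apply/eqP; rewrite eqn_leq !depP // ?Bs // -Bs.
have dep_orb d x : x \in porbit s d -> dep x = dep d.
  by case/mem_porbitP=> i _ ->; elim: i => //= i; rewrite deps.
pose good d x := [&& x \in porbit s d, ok x & dep (e x) < dep x]%N.
have goodP d : d \notin porbit s r -> exists x, good d x.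
  move=> rd; have := dep_mem d; case def_n: (dep d) => [|n] /=.
    by move=> rd'; case/negP: rd.
  rewrite !inE => /orP[/depP|]; first by rewrite def_n ltnn.
  case/existsP=> x /and3P[dx okx /depP lex].
  by exists x; rewrite /good dx okx (dep_orb _ _ dx) def_n ltnS.
have good_eq d x : x \in porbit s d -> good d =1 good x.
  by rewrite -eq_porbit_mem => /eqP E y; rewrite /good E.
pose c d := [pick x | good d x].
pose C := [set x in ~: porbit s r | c x == Some x].
have cP d x : x \in porbit s d -> c d = c x.
  by move=> dx; rewrite /c (eq_pick (good_eq _ _ dx)).
have CP x : x \in C -> good x x.
  rewrite !inE => /andP[_]; rewrite /c.
  by case: pickP => // y gy /eqP[E]; rewrite -{2}E.
exists C, dep; split; first exact: deps.
- by move=> x /CP/and3P[].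
- by move=> x /CP/and3P[].
- move=> x y Cx Cy xy; move: Cx Cy; rewrite !inE => /andP[_ /eqP cx] /andP[_ /eqP].
  by rewrite -(cP _ _ xy) cx => -[].
- by move=> x; rewrite !inE => /andP[].
move=> d rd; have [x gx] := goodP d rd.
case def_c: (c d) => [y|]; last first.
  by move: def_c; rewrite /c; case: pickP => // /(_ x); rewrite gx.
have gy : good d y by move: def_c; rewrite /c; case: pickP => // z gz [<-].
case/and3P: gy => dy _ _; exists y => //.
rewrite !inE -(cP _ _ dy) def_c eqxx andbT.
apply: contra rd => ry; rewrite porbit_sym -eq_porbit_mem.
move: dy ry; rewrite -!eq_porbit_mem => /eqP-> /eqP->; exact: eqxx.
Qed.

Variables (ok : pred D) (C : {set D}) (dep : D -> nat).
Hypothesis tree : spanning_tree e s ok r C dep.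

Lemma tree_dep_orbit d x : x \in porbit s d -> dep x = dep d.
Proof.
by case/mem_porbitP=> i _ ->; elim: i => //= i; rewrite (tree_dep tree).
Qed.

Lemma tree_opp x : x \in C -> e x \notin C.
Proof.
move=> Cx; apply/negP=> Cex; have := tree_lt tree Cex.
by rewrite eK ltnNge ltnW // (tree_lt tree).
Qed.

Lemma card_tree : #|C|.+1 = #|porbits s|.
Proof.
have r_s : porbit s r \in porbits s by apply: imset_f.
rewrite (cardsD1 (porbit s r)) r_s add1n; congr _.+1.
have inj : {in C &, injective (porbit s)}.
  by move=> x y Cx Cy xy; apply: (tree_uniq tree) => //; rewrite xy porbit_id.
rewrite -(card_in_imset inj); apply: eq_card => A; apply/imsetP/idP.
  case=> x Cx ->; rewrite !inE imset_f // andbT eq_porbit_mem.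
  exact: (tree_root tree).
rewrite !inE => /andP[Ar /imsetP[d _ defA]]; subst A.
rewrite eq_porbit_mem in Ar; have [x Cx dx] := tree_cover tree Ar.
by exists x => //; apply/esym/eqP; rewrite eq_porbit_mem.
Qed.

Lemma porbit_involution x y : (y \in porbit e x) = (y == x) || (y == e x).
Proof.
apply/idP/idP => [/mem_porbitP[i _ ->]|/orP[]/eqP->]; last first.
- by have := mem_porbit e 1 x; rewrite expg1.
- exact: porbit_id.
elim: i => [|i IHi]; first by rewrite eqxx.
by rewrite iterS; case/orP: IHi => /eqP->; rewrite ?eK eqxx ?orbT.
Qed.

(** Depth drops from [x] to [e x], so the two darts of an edge are never both parent darts. *)
Lemma card_tree_edges : #|porbit e @: C| = #|C|.
Proof.
apply: card_in_imset => x y Cx Cy xy; have := porbit_id e y.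
rewrite -xy porbit_involution => /orP[]/eqP // yx.
by have := tree_opp Cx; rewrite -yx Cy.
Qed.

End SpanningTree.

(** * Complementary trees and the factorisation of the boundary word *)

Section TreeCotree.
Variables (D : finType) (e f : {perm D}) (r : D).
Let n := e * f.
Hypothesis eK : forall d, e (e d) = d.
Hypothesis conn : forall U : D -> Prop, U r -> (forall d, U d -> U (f d)) ->
  (forall d, U d -> U (e d)) -> forall d, U d.
Hypothesis euler : (#|porbits n| + #|porbits f| = #|porbits e| + 2)%N.

Variables (C : {set D}) (dep : D -> nat).
Hypothesis cotree : spanning_tree e f predT r C dep.

Let ok d := (d \notin C) && (e d \notin C).

(* A set of vertices that is left only through cotree edges is left by no edge:
   around the deepest faces first, at most one dart of each face, its parent
   dart, could leave it, and a closed walk cannot cross a cut just once. *)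
Lemma cotree_complement_connected (U : D -> Prop) :
  U r -> (forall d, U d -> U (n d)) -> (forall d, ok d -> U d -> U (e d)) ->
  forall d, U d.
Proof.
move=> Ur Un Ue.
have Uf d : U (e d) <-> U (f d).
  by rewrite -{2}[d]eK -[f _]permM; symmetry; apply: perm_invariant_iff.
have okE d : ok (e d) = ok d by rewrite /ok eK andbC.
pose M := \max_d dep d.
have leM d : (dep d <= M)%N by apply: leq_bigmax.
have Q k : forall d, (M - dep d < k)%N -> U d <-> U (e d).
  elim: k => // k IHk d; rewrite ltnS => le_d.
  have QnC x : dep x = dep d -> x \notin C -> U x <-> U (e x).
    move=> dx Cx; have [Cex|Cex] := boolP (e x \in C); last first.
      have okx : ok x by rewrite /ok Cx.
      by split=> [|Uex]; [apply: Ue|rewrite -[x]eK; apply: Ue; rewrite ?okE].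
    symmetry; rewrite -{2}[x]eK; apply: IHk; apply: leq_trans le_d.
    have := tree_lt cotree Cex; rewrite eK -dx => lt_x.
    by rewrite ltn_sub2l // (leq_trans lt_x).
  have [Cd|] := boolP (d \in C); last exact: QnC.
  (* As [d] is the only parent dart of its face, the walk from the end of [d] round the face back to
     its source uses other darts only, and these preserve [U]. *)
  have walk j : (j < #|porbit f d|)%N -> U (iter j.+1 f d) <-> U (f d).
    elim: j => [//|j IHj] ltj; have Ij := IHj (ltnW ltj).
    have dy : iter j.+1 f d \in porbit f d.
      by rewrite porbit_traject; apply/trajectP; exists j.+1.
    rewrite (iterS j.+1); set y := iter j.+1 f d in Ij dy *.
    rewrite -Uf -Ij; symmetry; apply: QnC; first exact: (tree_dep_orbit cotree).
    apply/negP=> Cy; have dE := tree_uniq cotree Cd Cy dy.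
    have := uniq_traject_porbit f d; move/(uniqP d)/(_ 0 j.+1).
    rewrite !inE size_traject !nth_traject //; last exact: leq_ltn_trans ltj.
    by move=> /(_ (leq_ltn_trans _ ltj) ltj dE); move/(_ isT).
  have m_gt0 : (0 < #|porbit f d|)%N by rewrite lt0n card_porbit_neq0.
  have := walk #|porbit f d|.-1; rewrite prednK // iter_porbit => /(_ (leqnn _)) ->.
  by symmetry.
have QM d : U d <-> U (e d) by apply: (Q M.+1); rewrite ltnS leq_subr.
apply: (conn Ur) => d Ud; first by apply/Uf; apply/(QM d).
by apply/(QM d).
Qed.

(* By Euler's formula the edges used by the two trees exhaust all edges, so
   every edge outside the cotree is a tree edge. *)
Lemma complementary_spanning_tree :
  exists C' dep', spanning_tree e n ok r C' dep' /\
    forall d, ok d -> (d \in C') || (e d \in C').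
Proof.
have okE d : ok (e d) = ok d by rewrite /ok eK andbC.
have [C' [dep' tree']] := spanning_tree_exists eK okE cotree_complement_connected.
exists C', dep'; split=> // d okd.
pose E1 := porbit e @: C; pose E2 := porbit e @: C'.
have dis : [disjoint E1 & E2].
  apply/pred0P=> A /=; apply/negP=> /andP[/imsetP[x Cx ->] /imsetP[y Cy xy]].
  have := tree_ok tree' Cy; rewrite /ok; have := porbit_id e y.
  rewrite -xy porbit_involution // => /orP[]/eqP->; rewrite ?eK Cx // andbF //.
have card12 : #|E1 :|: E2| = #|porbits e|.
  rewrite cardsU disjoint_setI0 // cards0 subn0.
  rewrite (card_tree_edges eK cotree) (card_tree_edges eK tree').
  apply/eqP; rewrite -(eqn_add2r 2) -euler -(card_tree cotree) -(card_tree tree').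
  by rewrite addnS !addSn addn1 addnC addnS.
have sub12 : E1 :|: E2 \subset porbits e.
  by apply/subsetP=> A; rewrite inE => /orP[]/imsetP[x _ ->]; apply: imset_f.
have : porbit e d \in E1 :|: E2.
  have /eqP-> : E1 :|: E2 == porbits e by rewrite eqEcard sub12 card12 leqnn.
  exact: imset_f.
case/andP: okd => Cd Ced; rewrite inE => /orP[]/imsetP[x Cx dx].
  have := porbit_id e x; rewrite -dx porbit_involution // => /orP[]/eqP xE.
    by rewrite -xE Cx in Cd.
  by rewrite -xE Cx in Ced.
have := porbit_id e x; rewrite -dx porbit_involution // => /orP[]/eqP <-.
  by rewrite Cx.
by rewrite Cx orbT.
Qed.

(* wt x is the number of faces below the dart x in the cotree. *)
Lemma subtree_weights : exists wt : D -> nat,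
  (forall d, wt d = (1 + \sum_(x in C | e x \in porbit f d) wt x)%N) /\
  (\sum_(x in C | e x \in porbit f r) wt x = #|C|)%N.
Proof.
pose M := \max_d dep d.
have leM d : (dep d <= M)%N by apply: leq_bigmax.
have [g h d gh|wt wtE] := depth_recursion 0%N (dep := fun d => (M - dep d)%N)
  (F := fun g d => (1 + \sum_(x in C | e x \in porbit f d) g x)%N).
  congr (1 + _)%N; apply: eq_bigr => x /andP[Cx dx]; apply: gh.
  have := tree_lt cotree Cx; rewrite (tree_dep_orbit cotree dx) => lt_dx.
  by rewrite ltn_sub2l // (leq_trans lt_dx).
exists wt; split=> //.
(* Double counting: when [wtE] is summed over [C], each [y] in [C] is counted once, at the parent
   dart of the face of [e y], unless that face is the outer one. *)
have total : (\sum_(x in C) wt x = #|C| +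
    \sum_(x in C | e x \notin porbit f r) wt x)%N.
  rewrite (eq_bigr _ (fun x _ => wtE x)) big_split /= sum1_card; congr (_ + _)%N.
  rewrite (exchange_big_dep (mem C)) /= => [|x y _ /andP[]//].
  rewrite [RHS]big_mkcondr /=; apply: eq_bigr => y Cy.
  case: ifP => [ry|/negbFE ry]; last first.
    apply: big1 => x /andP[Cx /andP[_ yx]]; have := tree_root cotree Cx.
    move: yx ry; rewrite -!eq_porbit_mem => /eqP-> /eqP->.
    by rewrite eqxx.
  have [x Cx yx] := tree_cover cotree ry.
  rewrite (big_pred1 x) // => z /=; rewrite Cy /=.
  apply/andP/eqP => [[Cz yz]|->]; last by rewrite porbit_sym.
  apply: (tree_uniq cotree) => //; move: yx yz; rewrite -!eq_porbit_mem.
  by move=> /eqP-> /eqP->.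
apply: (@addIn (\sum_(x in C | e x \notin porbit f r) wt x)%N).
by rewrite -total [RHS](bigID (fun x => e x \in porbit f r)).
Qed.

Section Labels.
Variables (T : groupType) (lab : D -> T).
Hypothesis labE : forall d, lab (e d) = (lab d)^-1.

(** The potential is defined by recursion on the depth in the vertex tree. An edge outside the
    cotree is a tree edge in one of its two directions, and [labE] transfers the equation to the
    other. *)
Lemma tree_potential : exists pot : D -> T,
  [/\ pot r = 1, forall d, pot (n d) = pot d &
     forall d, ok d -> pot d * lab d = pot (e d)].
Proof.
have [C' [dep' [tree' okC']]] := complementary_spanning_tree.
pose up d := [pick x | (x \in C') && (porbit n d == porbit n x)].
have upE d : up (n d) = up d by apply: eq_pick => x; rewrite porbit_step.
have upC x : x \in C' -> up x = Some x.
  move=> Cx; rewrite /up; case: pickP => [y /andP[Cy xy]|/(_ x)]; last first.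
    by rewrite Cx eqxx.
  by congr Some; apply: (tree_uniq tree') => //; rewrite -eq_porbit_mem.
have [g h d gh|pot potE] := depth_recursion 1 (dep := dep')
  (F := fun (g : D -> T) d => if up d is Some x then g (e x) * (lab x)^-1 else 1).
  rewrite /up; case: pickP => // x /andP[Cx dx]; rewrite gh //.
  rewrite -(tree_dep_orbit tree' (d := d) (x := x)) ?(tree_lt tree') //.
  by rewrite -eq_porbit_mem eq_sym.
have potC x : x \in C' -> pot x * lab x = pot (e x).
  by move=> Cx; rewrite potE upC // mulgVK.
exists pot; split=> [|d|d /okC'/orP[/potC//|/potC]].
- rewrite potE /up; case: pickP => // x /andP[Cx]; rewrite eq_porbit_mem porbit_sym.
  by rewrite (negPf (tree_root tree' Cx)).
- by rewrite potE upE -potE.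
by rewrite eK labE => <-; rewrite mulgVK.
Qed.

(* pot d is the label of the tree path from r to the source of d. The element
   pot d * lab d * pot (e d)^-1 is trivial on tree edges, and the face equations
   express it on a cotree edge by the faces below that edge. *)
Theorem planar_van_kampen : exists pot : D -> T,
  [/\ pot r = 1, forall d, pot (n d) = pot d &
   forall S : T -> Prop, (forall s, S s -> S s^-1) ->
   (forall d, d \notin porbit f r -> exists2 d', d' \in porbit f d &
      S (pot d' * (\prod_(x <- traject f d' #|porbit f d'|) lab x) * (pot d')^-1)) ->
   nprod S #|porbits f|.-1 (\prod_(x <- traject f r #|porbit f r|) lab x) /\
   forall d, exists k, nprod S k (pot d * lab d * (pot (e d))^-1)].
Proof.
have [pot [pot_r potn pot_ok]] := tree_potential; exists pot; split=> // S SV faceS.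
pose tau d := pot d * lab d * (pot (e d))^-1.
have potf d : pot (f d) = pot (e d) by rewrite -(potn (e d)) permM eK.
have tauE d : tau (e d) = (tau d)^-1.
  by rewrite /tau !invgM !invgK labE eK mulgA.
have tau_ok d : ok d -> tau d = 1 by move=> /pot_ok E; rewrite /tau E mulgV.
have telescope d m : \prod_(x <- traject f d m) tau x =
    pot d * (\prod_(x <- traject f d m) lab x) * (pot (iter m f d))^-1.
  elim: m d => [|m IHm] d; first by rewrite !big_nil mulg1 mulgV.
  by rewrite trajectS !big_cons IHm iterSr potf /tau !mulgA mulgVK.
have [wt [wtE wt_r]] := subtree_weights.
(* This is [wt (e d)] if [e d] is a parent dart and 0 otherwise: the number of faces hanging below
   [d]. *)
pose kk d := (\sum_(x in C | e x == d) wt x)%N.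
have sum_kk d : (\sum_(y <- traject f d #|porbit f d|) kk y =
    \sum_(x in C | e x \in porbit f d) wt x)%N.
  rewrite big_uniq ?uniq_traject_porbit //=.
  rewrite [RHS](partition_big e (mem (porbit f d))) /= => [|x /andP[]//].
  rewrite (eq_bigl (mem (porbit f d))) => [|y]; last by rewrite /= porbit_traject.
  apply: eq_bigr => y /= dy; apply: eq_bigl => x.
  by case: eqP => [->|]; rewrite ?andbF // dy !andbT.
have nonparent d : d \notin C ->
    (forall x, x \in C -> e x = d -> nprod S (wt x) (tau x)) ->
    nprod S (kk d) (tau d).
  move=> Cd IH; have [Ced|Ced] := boolP (e d \in C); last first.
    by rewrite tau_ok ?/ok ?Cd //; apply: nprod1.
  rewrite -[d in tau d]eK tauE; apply: nprodV => //.
  apply: nprod_leq (IH _ Ced (eK d)).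
  by rewrite /kk (bigD1 (e d)) /= ?leq_addr // Ced eK eqxx.
pose M := \max_d dep d.
have leM d : (dep d <= M)%N by apply: leq_bigmax.
(* Induction from the deepest faces: the face equation is solved for [tau x], at the price of one
   factor for the face itself and [kk y] factors for every other dart [y] on it. *)
have parent k x : (M - dep x < k)%N -> x \in C -> nprod S (wt x) (tau x).
  elim: k x => // k IHk x; rewrite ltnS => le_x Cx.
  have [d' xd' Sd'] := faceS x (tree_root cotree Cx).
  have d'x : x \in porbit f d' by rewrite porbit_sym.
  have eqx : porbit f d' = porbit f x by apply/eqP; rewrite eq_porbit_mem.
  have IH y : y \in porbit f d' -> y != x -> nprod S (kk y) (tau y).
    rewrite eqx => xy neyx; apply: nonparent => [|z Cz ezy].
      by apply: contraNN neyx => Cy; rewrite (tree_uniq cotree Cx Cy xy).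
    apply: IHk => //; apply: leq_trans le_x; have := tree_lt cotree Cz.
    rewrite ezy (tree_dep_orbit cotree xy) => ltxz.
    by rewrite ltn_sub2l // (leq_trans ltxz).
  have := telescope d' #|porbit f d'|; rewrite iter_porbit => telE.
  move: Sd'; rewrite -telE wtE -eqx -sum_kk.
  have tx : x \in traject f d' #|porbit f d'| by rewrite -porbit_traject.
  have memE y := porbit_traject f d' y.
  move: memE (uniq_traject_porbit f d'); case/splitPr: tx => s1 s2 memE.
  rewrite cat_uniq /= negb_or => /and3P[_ /andP[x1 _] /andP[x2 _]].
  rewrite !big_cat !big_cons /= => SE.
  have k1 : nprod S (\sum_(y <- s1) kk y) (\prod_(y <- s1) tau y).
    apply: nprod_prod => y s1y; apply: IH; first by rewrite memE mem_cat s1y.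
    by apply: contraNneq x1 => <-.
  have k2 : nprod S (\sum_(y <- s2) kk y) (\prod_(y <- s2) tau y).
    apply: nprod_prod => y s2y; apply: IH; first by rewrite memE mem_cat inE s2y !orbT.
    by apply: contraNneq x2 => <-.
  set P1 := \prod_(y <- s1) _ in k1 SE *; set P2 := \prod_(y <- s2) _ in k2 SE *.
  have -> : tau x = P1^-1 * (P1 * (tau x * P2)) * P2^-1.
    by rewrite mulKg mulgK.
  apply: (@nprod_leq _ _ (\sum_(y <- s1) kk y + 1 + \sum_(y <- s2) kk y)%N).
    by rewrite addnAC addnC leq_add2l leq_add2l leq_addl.
  by apply: nprodM; [apply: nprodM; [apply: nprodV|apply: nprod_gen]|apply: nprodV].
have tauS d : exists k, nprod S k (tau d).
  have [Cd|Cd] := boolP (d \in C).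
    by exists (wt d); apply: (parent M.+1); rewrite ?ltnS ?leq_subr.
  exists (kk d); apply: nonparent => // x Cx _.
  by apply: (parent M.+1); rewrite ?ltnS ?leq_subr.
split=> //; have := telescope r #|porbit f r|.
rewrite iter_porbit pot_r invg1 mulg1 mul1g => <-.
(* The weights hanging from the outer face add up to [#|C|], the number of inner faces. *)
rewrite -(card_tree cotree) /= -wt_r -sum_kk; apply: nprod_prod => y.
rewrite -porbit_traject => ry; apply: nonparent => [|x Cx _]; last first.
  by apply: (parent M.+1); rewrite ?ltnS ?leq_subr.
by apply/negP=> /(tree_root cotree); rewrite ry.
Qed.

End Labels.

End TreeCotree.

(** * Van Kampen diagrams *)

Section PlaneMaps.
Variable M : plane_map.
Local Notation e := (edge M).
Local Notation f := (face M).
Local Notation o := (outer M).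

Lemma plane_map_ind (U : dart M -> Prop) :
  U o -> (forall d, U d -> U (f d)) -> (forall d, U d -> U (e d)) ->
  forall d, U d.
Proof.
move=> Uo Uf Ue d; case/connectP: (map_connected o d) => p + ->.
elim: p o Uo => //= y p IHp x Ux /andP[xy]; apply: IHp.
by case/orP: xy => /eqP->; [apply: Ue|apply: Uf].
Qed.

Lemma vertex_face d : vertex (f d) = vertex (e d).
Proof. by rewrite /vertex -(porbit_step _ (e d)) permM edgeK. Qed.

Lemma vertex_adj_edge d : vertex_adj (vertex d) (vertex (e d)).
Proof. by apply/existsP; exists d; rewrite !eqxx. Qed.

Lemma vertex_adj_edgeV d : vertex_adj (vertex (e d)) (vertex d).
Proof. by rewrite -{2}(edgeK d) vertex_adj_edge. Qed.

(** A path without repeated vertices to the outer dart is shorter than the number of vertices, so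
    the [find] in [boundary_dist] succeeds and does not return its default. *)
Lemma path_to_boundary d : exists p : seq {set dart M},
  [/\ path (@vertex_adj M) (vertex d) p,
      last (vertex d) p \in boundary_vertices M & (size p <= map_radius M)%N].
Proof.
pose reach k := [exists p : k.-tuple {set dart M},
  path (@vertex_adj M) (vertex d) p &&
  (last (vertex d) p \in boundary_vertices M)].
have has_reach : has reach (iota 0 #|porbits (node M)|).
  have : connect (@vertex_adj M) (vertex d) (vertex o).
    move: d {reach}; apply: plane_map_ind => [|d IH|d IH]; first exact: connect0.
      by rewrite vertex_face; apply: connect_trans (connect1 (vertex_adj_edgeV d)) IH.
    exact: connect_trans (connect1 (vertex_adj_edgeV d)) IH.
  case/connectP=> p0 p0P; case/shortenP: p0P => p pP uniq_p _ lastp.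
  apply/hasP; exists (size p); last first.
    apply/existsP; exists (in_tuple p); rewrite /= pP.
    by apply/imsetP; exists o; rewrite ?porbit_id -?lastp.
  rewrite mem_iota add0n /= -[X in (X <= _)%N]/(size (vertex d :: p)) cardE.
  apply: uniq_leq_size => // A; rewrite mem_enum inE => /predU1P[->|].
    exact: imset_f.
  elim: p (vertex d) pP {uniq_p lastp} => //= B p IHp A' /andP[/existsP[x]].
  case/andP=> _ /eqP-> pP; rewrite inE => /predU1P[->|]; first exact: imset_f.
  exact: IHp pP.
have := nth_find 0%N has_reach; rewrite has_find in has_reach.
rewrite size_iota in has_reach; rewrite nth_iota // add0n.
case/existsP=> p /andP[pP lastp]; exists p; split=> //; rewrite size_tuple.
have Vd : vertex d \in porbits (node M) by apply: imset_f.
exact: (@leq_bigmax_cond _ _ (@boundary_dist M) _ Vd).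
Qed.

End PlaneMaps.

Section Diagrams.
Variables (X : finType) (rels : seq (word X)) (G : groupType).
Variable v : UMagmaMorphism.type (free_group X) G.
Hypothesis v_rel : forall r, is_relator rels r -> v (free_of_word r) = 1.

(* u leads from the start of w to a vertex at distance at most k from it. *)
Definition near_path (w : word X) (k : nat) (u : free_group X) : Prop :=
  exists j w', (size w' <= k)%N /\
    v u = v (free_of_word (take j w)) * v (free_of_word w').

(** The conjugators are tree paths, which may be long. Their values under [v] do not depend on the
    path taken, so each can be replaced by a piece of the boundary followed by a shortest path
    inwards. *)
Theorem van_kampen (w : word X) (D : vk_diagram rels w) :
  nprod (rel_conj rels (near_path w (vk_radius D))) (vk_area D) (free_of_word w).
Proof.
case: D => [w0|M lab labE face_w face_rel] /=; first by rewrite w0; apply: nprod1.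
pose e := edge M; pose f := face M; pose o := outer M.
pose labT d := free_of_word [:: lab d].
have labTE d : labT (e d) = (labT d)^-1 by rewrite /labT labE -free_of_word_inv.
have face_prod d : free_of_word (face_word lab d) =
    \prod_(x <- traject f d #|porbit f d|) labT x.
  rewrite /face_word; elim: (traject _ _ _) => [|x s IHs]; first by rewrite big_nil.
  by rewrite big_cons /= -cat1s free_of_word_cat IHs.
have eK : forall d, e (e d) = d := @edgeK M.
have indM := @plane_map_ind M.
have [C [dep cotree]] : exists C dep, spanning_tree e f predT o C dep.
  by apply: spanning_tree_exists => // U Uo Uf Ue; apply: indM => // d; apply: Ue.
have [pot [pot_o pot_n potP]] :=
  planar_van_kampen eK indM (map_euler M) cotree labTE.
pose h d := v (pot d).
(* First use of [potP], with unrestricted conjugates: their products die under [v], so [h] follows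
   the labels along all edges and not only along tree edges. *)
have h_step d : h d * v (labT d) = h (e d).
  have [S face_S|_ /(_ d)[k]] := potP (any_conj rels) (@rel_conjV _ rels _).
    have [d' dd' rel_d'] := face_rel _ face_S; exists d' => //.
    by exists (pot d'), (face_word lab d'); rewrite face_prod.
  move/nprod_ker=> /(_ _ v) E; apply: divg1_eq; rewrite -gmulfM -gmulfV -gmulfM.
  apply: E => s [u [r [_ /v_rel vr ->]]].
  by rewrite !gmulfM vr mulg1 -gmulfM mulgV gmulf1.
have h_vertex d d' : vertex d = vertex d' -> h d = h d'.
  move/eqP; rewrite eq_porbit_mem => /mem_porbitP[i _ ->].
  by elim: i => //= i; rewrite /h pot_n.
have h_boundary j : (j <= #|porbit f o|)%N ->
    h (iter j f o) = v (free_of_word (take j w)).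
  move=> lej; rewrite -face_w /face_word -map_take take_traject //.
  elim: j {lej} => [|j IHj]; first by rewrite /h pot_o !gmulf1.
  rewrite iterS (h_vertex _ (e (iter j f o))) ?vertex_face // -h_step IHj.
  by rewrite trajectSr map_rcons -cats1 free_of_word_cat gmulfM.
have h_path p d : path (@vertex_adj M) (vertex d) p -> exists d' w',
    [/\ last (vertex d) p = vertex d', size w' = size p &
        h d' = h d * v (free_of_word w')].
  elim: p d => [|A p IHp] d /=; first by exists d, [::]; rewrite gmulf1 mulg1.
  case/andP=> /existsP[x /andP[/eqP dx /eqP->]] /IHp[d' [w' [-> sw' hd']]].
  exists d', (lab x :: w'); split; rewrite //= ?sw' //.
  by rewrite -cat1s free_of_word_cat gmulfM hd' -h_step (h_vertex _ _ dx) mulgA.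
have near d : near_path w (map_radius M) (pot d).
  have [p [pP + lep]] := path_to_boundary d.
  have [d' [w' [-> sw' hd']]] := h_path p d pP; case/imsetP=> d'' od'' dd''.
  have [j ltj defd''] := mem_porbitP _ _ _ od''.
  exists j, (inv_word w'); split; first by rewrite size_inv_word sw'.
  rewrite -h_boundary 1?ltnW // -defd'' -(h_vertex _ _ dd'') hd'.
  by rewrite free_of_word_inv gmulfV mulgK.
(* Second use of [potP], for the same potential, now that all its values are known to be near the
   boundary. *)
have [|+ _] := potP _ (@rel_conjV _ rels (near_path w (map_radius M))).
  move=> d /face_rel[d' dd' rel_d']; exists d' => //.
  by exists (pot d'), (face_word lab d'); rewrite face_prod.
rewrite -face_prod face_w /map_area (cardsD1 (porbit f o)) imset_f //.
Qed.

End Diagrams.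

(** * Crossed maps *)

Section IntegerPowers.
Variable G : groupType.
Implicit Types (x y : G) (a b : int).

Definition zpow x a : G :=
  match a with Posz n => x ^+ n | Negz n => x ^- n.+1 end.

Lemma zpow0 x : zpow x 0 = 1. Proof. by []. Qed.

Lemma zpow1 x : zpow x 1 = x. Proof. by []. Qed.

Lemma zpowS x a : zpow x (a + 1)%R = zpow x a * x.
Proof.
case: a => n /=; first by rewrite addn1 expgSr.
case: n => [|n]; first by rewrite /= mulVg.
have -> : (Negz n.+1 + 1 = Negz n)%R by rewrite !NegzE -addn1 PoszD opprD addrNK.
by rewrite /= [in RHS]expgS invgM mulgVK.
Qed.

Lemma zpowD x a b : zpow x (a + b)%R = zpow x a * zpow x b.
Proof.
elim/int_rect: b => [|n IHn|n IHn]; first by rewrite addr0 zpow0 mulg1.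
  by rewrite -addn1 PoszD addrA !zpowS IHn mulgA.
apply: (mulIg x); rewrite -zpowS -mulgA -zpowS -addn1 PoszD opprD.
by rewrite !addrA !addrNK.
Qed.

Lemma zpowN x a : zpow x (- a)%R = (zpow x a)^-1.
Proof. by apply: (mulIg (zpow x a)); rewrite mulVg -zpowD addNr. Qed.

Lemma zpowM x a b : zpow x (a * b)%R = zpow (zpow x a) b.
Proof.
elim/int_rect: b => [|n IHn|n IHn]; first by rewrite mulr0.
  by rewrite -addn1 PoszD mulrDr mulr1 !zpowD IHn.
by rewrite -addn1 PoszD opprD mulrDr mulrN1 !zpowD IHn !zpowN.
Qed.

End IntegerPowers.

Lemma gmulf_zpow (G H : groupType) (h : UMagmaMorphism.type G H) x a :
  h (zpow x a) = zpow (h x) a.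
Proof. by case: a => n /=; rewrite ?gmulfV gmulfXn. Qed.

Arguments zpow : simpl never.

Section CrossedMaps.
Variables (Z : finType) (Q T : groupType).
Variable d : UMagmaMorphism.type (free_group Z) Q.
Implicit Types (q : Q) (x y : free_group Z).

(** Equivalently, a morphism to [T] from the action groupoid of the free group on [Q]: [Phi q x] is
    the value of the path labelled [x] that starts at [q]. *)
Definition crossed (Phi : Q -> free_group Z -> T) : Prop :=
  forall q x y, Phi q (x * y) = Phi q x * Phi (q * d x) y.

(** The values on edges can be prescribed freely. An inverse letter receives the inverse of the
    value of the edge read from its other end, so cancelling pairs contribute nothing. *)
Lemma crossed_exists (f : Q -> Z -> T) :
  exists2 Phi, crossed Phi & forall q z, Phi q (free_gen z) = f q z.
Proof.
pose D q (a : letter Z) := q * d (free_of_word [:: a]).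
pose F q (a : letter Z) :=
  if a.2 then (f (D q a) a.1)^-1 else f q a.1.
pose fix Phi q (w : word Z) : T :=
  if w is a :: w' then F q a * Phi (D q a) w' else 1.
have PhiK q a w : Phi q [:: a, inv_letter a & w] = Phi q w.
  have DK : D (D q a) (inv_letter a) = q.
    rewrite /D -mulgA -gmulfM -free_of_word_cat (free_of_word_catV [:: a]).
    by rewrite gmulf1 mulg1.
  rewrite /= DK mulgA /F DK; case: a {DK} => z [] /=; rewrite ?mulVg ?mulgV mul1g //.
have Phi_reduce q w : Phi q (free_reduce w) = Phi q w.
  elim: w q => // a w IHw q; rewrite [RHS]/= -IHw.
  rewrite free_reduceE /= -free_reduceE.
  case: (free_reduce w) => [|b s] //=; case: eqP => [->|//].
  by rewrite -(PhiK q a s).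
have Phi_cat q u w : Phi q (u ++ w) = Phi q u * Phi (q * d (free_of_word u)) w.
  elim: u q => [|a u IHu] q; first by rewrite free_of_word_nil gmulf1 mulg1 mul1g.
  by rewrite /= IHu (free_of_word_cat [:: a] u) gmulfM !mulgA.
exists (fun q x => Phi q x) => [q x y|q z]; last first.
  by rewrite Phi_reduce /= mulg1.
by rewrite Phi_reduce Phi_cat free_wordK.
Qed.

Section Theory.
Variable Phi : Q -> free_group Z -> T.
Hypothesis PhiM : crossed Phi.

Lemma crossed1 q : Phi q 1 = 1.
Proof.
have := PhiM q 1 1; rewrite gmulf1 !mulg1 => E.
by apply: (mulIg (Phi q 1)); rewrite mul1g -E.
Qed.

Lemma crossedV q x : Phi q x^-1 = (Phi (q * (d x)^-1) x)^-1.
Proof.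
apply: (mulIg (Phi (q * (d x)^-1) x)).
by rewrite mulVg -(gmulfV d) -PhiM mulVg crossed1.
Qed.

Lemma crossedJ q u x : d x = 1 ->
  Phi q (u * x * u^-1) = Phi q u * Phi (q * d u) x * (Phi q u)^-1.
Proof. by move=> dx; rewrite PhiM crossedV PhiM gmulfM dx mulg1 mulgK. Qed.

End Theory.

(** Agreement is compared on a set [I] of positions closed under moving, because the sections are
    controlled only over a subgroup of [Q]. *)
Lemma crossed_eq (I : Q -> Prop) (Phi Psi : Q -> free_group Z -> T) :
  crossed Phi -> crossed Psi -> (forall q x, I q -> I (q * d x)) ->
  (forall q z, I q -> Phi q (free_gen z) = Psi q (free_gen z)) ->
  forall q x, I q -> Phi q x = Psi q x.
Proof.
move=> PhiM PsiM Id Pg q x; move: x q.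
apply: free_ind => [q _|z x IHx q Iq|z x IHx q Iq]; first by rewrite !crossed1.
  by rewrite PhiM PsiM Pg // IHx //; apply: Id.
rewrite PhiM PsiM (crossedV PhiM) (crossedV PsiM) -(gmulfV d).
by rewrite Pg ?IHx //; apply: Id.
Qed.

End CrossedMaps.

(** * Pushing words down to the normal subgroup *)

Section Pushdown.
Variables (N G Q : groupType).
Variables (i : UMagmaMorphism.type N G) (p : UMagmaMorphism.type G Q).
Hypothesis i_inj : injective i.
Hypothesis exact_G : forall x, p x = 1 <-> exists y, i y = x.
Hypothesis Qab : forall x y : Q, x * y = y * x.
Variable P : finite_presentation N.
Local Notation null_conj := (any_conj (rels P)).

Definition qval (Z : finType) (v : Z -> G) : free_group Z -> Q :=
  p \o free_lift v.

HB.instance Definition _ Z v := UMagmaMorphism.on (@qval Z v).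

(* The subgroup H of G generated by v contains N and is presented by v and rl.
   For q in H/N, Phi q pushes a word over v, read from the point s q of the
   fibre over q, down to N along the section s. *)
Record pushdown (Z : finType) (v : Z -> G) (rl : seq (word Z))
    (Phi : Q -> free_group Z -> free_group (gens P)) (s : Q -> G) : Prop :=
  Pushdown {
    push_ker : forall x, free_lift v x = 1 <-> exists k, nprod (any_conj rl) k x;
    push_normal : forall n, exists x, free_lift v x = i n;
    push_crossed : crossed (qval v) Phi;
    push_sec1 : s 1 = 1;
    push_sec : forall q x, (exists u, q = qval v u) ->
      i (pres_val (Phi q x)) = s q * free_lift v x * (s (q * qval v x))^-1;
    push_bound : forall x, free_lift v x = 1 -> exists2 A, (0 < A)%N &
      forall w, nprod null_conj (A ^ (size w).+1)
        (Phi (qval v (free_of_word w)) x) }.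

(** Bounds for the finitely many relators suffice: conjugation by [u] merely shifts the position by
    the length of [u], which changes the base of the exponential. *)
Lemma push_bound_from_relators (Z : finType) (v : Z -> G) (rl : seq (word Z))
    (Phi : Q -> free_group Z -> free_group (gens P)) :
  crossed (qval v) Phi ->
  (forall r, is_relator rl r -> free_lift v (free_of_word r) = 1) ->
  (forall r, r \in rl -> exists2 A, (0 < A)%N & forall w,
     nprod null_conj (A ^ (size w).+1)
       (Phi (qval v (free_of_word w)) (free_of_word r))) ->
  forall k x, nprod (any_conj rl) k x -> exists2 A, (0 < A)%N & forall w,
     nprod null_conj (A ^ (size w).+1) (Phi (qval v (free_of_word w)) x).
Proof.
move=> PhiM v_rl bound_rl k x.
elim=> {k x} [k|k _ x [u [r [_ rl_r ->]]] _ [B B0 IHx]].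
  by exists 1%N => // w; rewrite (crossed1 PhiM); apply: nprod1.
have q_r : qval v (free_of_word r) = 1 by rewrite /qval /= v_rl ?gmulf1.
have [A A0 bound_r] : exists2 A, (0 < A)%N & forall w,
    nprod null_conj (A ^ (size w).+1)
      (Phi (qval v (free_of_word w)) (free_of_word r)).
  case/orP: rl_r q_r => [/bound_rl//|/bound_rl[A A0 bound_r]] q_r.
  exists A => // w; rewrite -[r]inv_wordK free_of_word_inv (crossedV PhiM) /=.
  have -> : qval v (free_of_word (inv_word r)) = 1.
    by rewrite free_of_word_inv gmulfV /= q_r invg1.
  by rewrite invg1 mulg1; apply: nprodV (bound_r w); apply: rel_conjV.
(* With [n] the size of [w] plus one, the shifted exponent is at most [(size u).+1 * n], and
   [a ^ n + B ^ n <= (a + B) ^ n] for [n > 0]. *)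
exists (A ^ (size (free_word u)).+1 + B)%N => [|w].
  by rewrite addn_gt0 B0 orbT.
rewrite PhiM !gmulfM /= q_r mulg1 -gmulfM mulgV gmulf1 mulg1.
apply: (@nprod_leq _ _ (A ^ (size (w ++ free_word u)).+1 + B ^ (size w).+1)).
  rewrite size_cat.
  apply: (@leq_trans ((A ^ (size (free_word u)).+1) ^ (size w).+1
                      + B ^ (size w).+1)).
    by rewrite leq_add2r -expnM leq_pexp2l // mulSn -addSn leq_add2l leq_pmulr.
  set a := (A ^ _)%N; elim: (size w).+1 (ltn0Sn (size w)) => // m IHm _.
  case: m IHm => [_|m /(_ isT) IHm]; first by rewrite !expn1.
  rewrite expnS (expnS B) (expnS (a + B)) mulnDl; apply: leq_add.
    by rewrite leq_mul2l (leq_trans _ IHm) ?orbT // leq_addr.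
  by rewrite leq_mul2l (leq_trans _ IHm) ?orbT // leq_addl.
apply: nprodM; last exact: IHx.
rewrite (crossedJ PhiM) //; apply: nprod_any_conjJ.
by rewrite -gmulfM -{2}[u]free_wordK -free_of_word_cat; apply: bound_r.
Qed.

Lemma free_lift_comp (x : free_group (gens P)) :
  free_lift (fun y => i (@gen_val N P y)) x = i (pres_val x).
Proof.
move: x; apply: free_ind => [|z x IHx|z x IHx]; first by rewrite !gmulf1.
  by rewrite !gmulfM /= IHx free_lift_gen pres_val_gen.
by rewrite !gmulfM !gmulfV /= IHx free_lift_gen pres_val_gen.
Qed.

(** The case [H = N]: every position is trivial and there is nothing to push. *)
Lemma pushdown_base :
  pushdown (fun y => i (@gen_val N P y)) (rels P) (fun _ x => x) (fun=> 1).
Proof.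
have q1 x : qval (fun y => i (@gen_val N P y)) x = 1.
  by rewrite /qval /= free_lift_comp; apply/exact_G; exists (pres_val x).
have kerP x : free_lift (fun y => i (@gen_val N P y)) x = 1 <->
    exists k, nprod null_conj k x.
  rewrite free_lift_comp -pres_valP; split=> [|->]; last exact: gmulf1.
  by rewrite -(gmulf1 (s := i)) => /i_inj.
split=> //.
- move=> n; have [x <-] := pres_val_surj P n.
  by exists x; rewrite free_lift_comp.
- by move=> q x _; rewrite free_lift_comp invg1 mulg1 mul1g.
move=> x /kerP[k Px]; exists k.+1 => // w; apply: nprod_leq Px.
by rewrite expnS (leq_trans (leqnSn k)) // leq_pmulr // expn_gt0.
Qed.

End Pushdown.

Lemma uniform_bound (T : eqType) (l : seq T) (R : nat -> T -> Prop) :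
  (forall m n x, (m <= n)%N -> R m x -> R n x) ->
  {in l, forall x, exists n, R n x} -> exists n, {in l, forall x, R n x}.
Proof.
move=> Rle; elim: l => [|y l IHl] Rl; first by exists 0%N.
have [|n Rn] := IHl; first by move=> x lx; apply: Rl; rewrite inE lx orbT.
have [m Rm] := Rl y (mem_head y l); exists (maxn m n) => x.
rewrite inE => /predU1P[->|/Rn]; first by apply: Rle Rm; apply: leq_maxl.
by apply: Rle; apply: leq_maxr.
Qed.

Lemma absz_leqD (m n : int) : (`|(m + n)%R| <= `|m| + `|n|)%N.
Proof. by rewrite -lez_nat PoszD !abszE ler_normD. Qed.

(** * Congruence modulo the normal closure of the relators *)

Section EqvMod.
Variables (X : finType) (rels : seq (word X)).
Local Notation F := (free_group X).
Implicit Types (x y z t : F).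

Definition eqv_mod x y : Prop := exists k, nprod (any_conj rels) k (x * y^-1).

Lemma eqv_mod_refl x : eqv_mod x x.
Proof. by exists 0%N; rewrite mulgV; apply: nprod1. Qed.

Lemma eqv_mod_sym x y : eqv_mod x y -> eqv_mod y x.
Proof.
case=> k Rk; exists k; rewrite -[y]invgK -invgM.
by apply: nprodV Rk => s; apply: rel_conjV.
Qed.

Lemma eqv_mod_trans y x z : eqv_mod x y -> eqv_mod y z -> eqv_mod x z.
Proof.
case=> k Rk [l Rl]; exists (k + l)%N; rewrite -[x](mulgVK y) -mulgA.
exact: nprodM.
Qed.

Lemma eqv_modM x y x' y' :
  eqv_mod x x' -> eqv_mod y y' -> eqv_mod (x * y) (x' * y').
Proof.
case=> k Rk [l Rl]; exists (l + k)%N.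
have -> : x * y * (x' * y')^-1 = (x * (y * y'^-1) * x^-1) * (x * x'^-1).
  by rewrite invgM !mulgA mulgVK.
by apply: nprodM => //; apply: nprod_any_conjJ.
Qed.

Lemma eqv_modV x y : eqv_mod x y -> eqv_mod x^-1 y^-1.
Proof.
move=> /eqv_mod_sym[k /(nprod_any_conjJ x^-1)]; rewrite invgK => Rk; exists k.
by rewrite mulgA mulgVK invgK in Rk *.
Qed.

Lemma eqv_mod_zpow x y a : eqv_mod x y -> eqv_mod (zpow x a) (zpow y a).
Proof.
move=> xy; elim/int_rect: a => [|n IHn|n IHn]; first exact: eqv_mod_refl.
  by rewrite -addn1 PoszD !zpowS; apply: eqv_modM.
rewrite -addn1 PoszD opprD !zpowD; apply: eqv_modM => //.
by rewrite !zpowN; apply: eqv_modV.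
Qed.

Lemma eqv_mod_relator x y : free_word (x * y^-1) \in rels -> eqv_mod x y.
Proof.
move=> R; exists 1%N; apply: nprod_gen; exists 1, (free_word (x * y^-1)).
by rewrite mul1g invg1 mulg1 free_wordK /is_relator R.
Qed.

End EqvMod.

Section IteratedMorphism.
Variables (G : groupType) (h : UMagmaMorphism.type G G).

Definition iter_morph n : G -> G := iter n h.

Lemma iter_morph1 n : iter_morph n 1 = 1.
Proof. by elim: n => // n; rewrite /iter_morph iterS => ->; apply: gmulf1. Qed.

Lemma iter_morphM n : {morph iter_morph n : x y / x * y}.
Proof.
by elim: n => // n IHn x y; rewrite /iter_morph !iterS -gmulfM -IHn.
Qed.

HB.instance Definition _ n := isUMagmaMorphism.Build G G (iter_morph n)
  (iter_morph1 n, @iter_morphM n).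

End IteratedMorphism.

(** * Adjoining one generator to the subgroup *)

Section Step.
Variables (N G Q : groupType).
Variables (i : UMagmaMorphism.type N G) (p : UMagmaMorphism.type G Q).
Hypothesis exact_G : forall x, p x = 1 <-> exists y, i y = x.
Hypothesis Qab : forall x y : Q, x * y = y * x.
Variable P : finite_presentation N.
Local Notation null_conj := (any_conj (rels P)).

Variables (Z : finType) (v : Z -> G) (rl : seq (word Z)).
Variables (Phi : Q -> free_group Z -> free_group (gens P)) (s : Q -> G).
Hypothesis push : pushdown i p v rl Phi s.
Local Notation V := (free_lift v).
Local Notation qv := (qval p v).
Local Notation F := (free_group Z).

Let PhiM := push_crossed push.

Lemma push_relator r : is_relator rl r -> V (free_of_word r) = 1.
Proof.
move=> rl_r; apply/(push_ker push); exists 1%N; apply: nprod_gen.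
by exists 1, r; rewrite mul1g invg1 mulg1.
Qed.

(** As [Q] is abelian, the commutator of [g] with a generator of [H] lies in [N], hence in [H]. So
    conjugation by [g] maps [H] to itself and lifts generator by generator. *)
Lemma conj_lift_exists (g : G) :
  exists h : UMagmaMorphism.type F F, forall u, V (h u) = g * V u * g^-1.
Proof.
have lift z : exists u, V u = g * v z * g^-1.
  have [n defn] : exists n, i n = g * v z * g^-1 * (v z)^-1.
    apply/exact_G; rewrite !gmulfM !gmulfV.
    by rewrite [p g * _]Qab mulgK mulgV.
  have [u Vu] := push_normal push n; exists (u * free_gen z).
  by rewrite gmulfM /= free_lift_gen Vu defn mulgVK.
have [h0 h0P] := choice lift; exists (free_lift h0); apply: free_ind.
- by rewrite !gmulf1 mulg1 mulgV.
- by move=> z u IHu; rewrite !gmulfM /= IHu !free_lift_gen h0P !mulgA mulgVK.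
- move=> z u IHu; rewrite !gmulfM !gmulfV /= IHu !free_lift_gen h0P.
  by rewrite !invgM invgK !mulgA mulgVK.
Qed.

(** The exponents [b] with [x^b] in [H] form a subgroup of the integers, generated by its least
    positive element if there is one and by 0 otherwise. *)
Lemma order_mod_exists (x : G) : exists d : nat,
  forall b, (exists u, V u = zpow x b) <-> (d %| b)%Z.
Proof.
pose D n := `[< (0 < n)%N /\ exists u, V u = x ^+ n >].
have inV b b' : (exists u, V u = zpow x b) -> (exists u, V u = zpow x b') ->
    exists u, V u = zpow x (b + b')%R.
  by case=> u uE [u' uE']; exists (u * u'); rewrite gmulfM /= uE uE' zpowD.
have inVN b : (exists u, V u = zpow x b) -> exists u, V u = zpow x (- b)%R.
  by case=> u uE; exists u^-1; rewrite gmulfV /= uE zpowN.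
have [exD|noD] := pselect (exists n, D n); last first.
  exists 0%N => b; rewrite dvd0z; split=> [|/eqP->];
    last by exists 1; rewrite gmulf1 zpow0.
  case: b => [[|n]|n] Vb //; case: noD; exists n.+1; apply/asboolP; split=> //.
  by have := inVN _ Vb; rewrite NegzE opprK.
case: (ex_minnP exD) => d /asboolP[d0 Vd] min_d; exists d => b.
have Vdk (k : int) : exists u, V u = zpow x (k * d)%R.
  have [u uE] := Vd; exists (zpow u k).
  by rewrite gmulf_zpow /= uE mulrC zpowM.
split=> [Vb|/dvdzP[k ->]]; last exact: Vdk.
have Vr : exists u, V u = zpow x (b %% d)%Z.
  by rewrite /modz; apply: inV => //; apply/inVN/Vdk.
apply/dvdz_mod0P; case defr: (b %% d)%Z Vr => [[|r]|r] // Vr; last first.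
  by have := @modz_ge0 b d; rewrite defr eqz_nat -lt0n d0 => /(_ isT).
have := min_d r.+1; rewrite leqNgt => /(_ _)/negP[]; first by apply/asboolP.
by rewrite -ltz_nat -defr ltz_pmod.
Qed.

(* d is the order of x modulo H, with d = 0 if that order is infinite. Since
   a %/ 0 = 0 and a %% 0 = a, normal forms q x^(a %% d) cover both cases. *)
Variable x : G.
Variables (d : nat) (c : F).
Hypothesis dP : forall b, (exists u, V u = zpow x b) <-> (d %| b)%Z.
Hypothesis cP : V c = zpow x d.
Hypothesis c0 : d = 0%N -> c = 1.
Variables (bp bm : UMagmaMorphism.type F F).
Hypothesis bpP : forall u, V (bp u) = x * V u * x^-1.
Hypothesis bmP : forall u, V (bm u) = x^-1 * V u * x.

(* bp and bm lift conjugation by x and by x^-1 to the free group. They need not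
   be mutually inverse, so int_conj is not additive in a. *)
Definition int_conj (a : int) : F -> F :=
  match a with Posz n => iter_morph bp n | Negz n => iter_morph bm n.+1 end.

Lemma int_conj_morph a :
  (int_conj a 1 = 1) * {morph int_conj a : u w / u * w}.
Proof. by case: a => n; split; do [apply: gmulf1|apply: gmulfM]. Qed.

HB.instance Definition _ a := isUMagmaMorphism.Build F F (int_conj a)
  (int_conj_morph a).

Lemma int_conjP a u : V (int_conj a u) = zpow x a * V u * (zpow x a)^-1.
Proof.
case: a => n.
  rewrite /int_conj /iter_morph /zpow; elim: n => [|n IHn].
    by rewrite invg1 mulg1 mul1g.
  by rewrite iterS bpP IHn expgS invgM !mulgA.
rewrite /int_conj /iter_morph /zpow; elim: n => [|n IHn]; first by rewrite bmP invgK.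
by rewrite iterS bmP IHn (expgSr _ n.+1) !invgM !invgK !mulgA.
Qed.

Lemma qv_int_conj a u : qv (int_conj a u) = qv u.
Proof. by rewrite /qval /= int_conjP !gmulfM !gmulfV Qab mulKg. Qed.

Local Notation px a := (p (zpow x a)).
Definition inH (q : Q) : Prop := exists u, q = qv u.

Lemma inH_mul q u : inH q -> inH (q * qv u).
Proof. by case=> w ->; exists (w * u); rewrite gmulfM. Qed.

Lemma inH1 : inH 1. Proof. by exists 1; rewrite gmulf1. Qed.

(** The part of [x^a] that overflows into [H], as in addition with carry; it is 1 when [d = 0]. *)
Definition carry (a : int) : F := zpow c (a %/ d)%Z.

Lemma zpow_carry a : zpow x a = V (carry a) * zpow x (a %% d)%Z.
Proof.
by rewrite gmulf_zpow /= cP -zpowM -zpowD [(_ * (_ %/ _)%Z)%R]mulrC -divz_eq.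
Qed.

Lemma px_carry a : px a = qv (carry a) * px (a %% d)%Z.
Proof. by rewrite {1}zpow_carry gmulfM. Qed.

Lemma carry_reduced a : (a %% d)%Z = a -> carry a = 1.
Proof.
rewrite /carry => ar; have /eqP := divz_eq a d; rewrite ar.
rewrite -{1}[a]add0r (inj_eq (addIr a)) eq_sym mulf_eq0 => /orP[/eqP-> //|/eqP d0].
by rewrite d0 divz0.
Qed.

Lemma carryS a : carry (a + 1) = carry a * carry ((a %% d)%Z + 1).
Proof.
rewrite /carry -zpowD; congr zpow.
have [->|d0] := eqVneq d 0%N; first by rewrite !divz0.
by rewrite {1}(divz_eq a d) -addrA divzMDl.
Qed.

Lemma carryDd a : (a %% d)%Z = a -> carry (a + d) = c.
Proof.
move=> ar; have [d0|d0] := eqVneq d 0%N.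
  by rewrite d0 addr0 carry_reduced -?d0 // c0.
rewrite /carry addrC -{1}(mul1r (d : int)) divzMDl // zpowD zpow1 -/(carry a).
by rewrite carry_reduced // mulg1.
Qed.

(** Normal forms are unique: if two of them agree in [Q], then, [N] being contained in [H], the
    quotient of the powers of [x] lies in [H], so [d] divides the difference of the exponents. *)
Lemma fibre_decomposition : exists (dq : Q -> Q) (da : Q -> int),
  forall q b, inH q ->
    dq (q * px b) = q * qv (carry b) /\ da (q * px b) = (b %% d)%Z.
Proof.
pose dec q (t : Q * int) := [/\ inH t.1, (t.2 %% d)%Z = t.2 & q = t.1 * px t.2].
have decP q : exists t, (exists t, dec q t) -> dec q t.
  have [[t qt]|no] := pselect (exists t, dec q t); first by exists t.
  (* Default value at positions that have no normal form. *)
  by exists (1, 0%R) => /no.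
have [D DP] := choice decP.
exists (fun q => (D q).1), (fun q => (D q).2) => q b Hq.
have [|[u1 ->] + E] := DP (q * px b).
  exists (q * qv (carry b), (b %% d)%Z); split; rewrite ?modz_mod //=.
    exact: inH_mul.
  by rewrite px_carry mulgA.
set a := (D _).2 in E *; move=> ar; case: Hq E => u -> E.
have ab : (d %| (b - a)%R)%Z.
  apply/dP; have [n in_] : exists n, i n = (V u1)^-1 * V u * zpow x (b - a)%R.
    apply/exact_G; move: E; rewrite /qval /= => E.
    by rewrite zpowD zpowN !gmulfM !gmulfV mulgA -(mulgA _ (p (V u))) E mulKg mulgV.
  have [t Vt] := push_normal push n; exists (u^-1 * u1 * t).
  by rewrite !gmulfM !gmulfV /= Vt in_ !mulgA mulgK mulVg mul1g.
have abm : (b %% d)%Z = a by rewrite -ar; apply/eqP; rewrite eqz_mod_dvd.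
split=> //; apply: (mulIg (px a)); rewrite -E -mulgA; congr (_ * _).
by rewrite px_carry abm.
Qed.

Definition step_val (o : option Z) : G := if o is Some z then v z else x.
Local Notation V' := (free_lift step_val).
Local Notation qv' := (qval p step_val).
Local Notation F' := (free_group (option Z)).

Definition step_incl : F -> F' := free_lift (fun z => free_gen (Some z)).

HB.instance Definition _ := UMagmaMorphism.on step_incl.

Lemma step_incl_gen z : step_incl (free_gen z) = free_gen (Some z).
Proof. exact: free_lift_gen. Qed.

Lemma step_val_incl u : V' (step_incl u) = V u.
Proof.
move: u; apply: free_ind => [|z u IHu|z u IHu]; first by rewrite !gmulf1.
  by rewrite !gmulfM /= IHu step_incl_gen !free_lift_gen.
by rewrite !gmulfM !gmulfV /= IHu step_incl_gen !free_lift_gen.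
Qed.

Lemma qv_step_incl u : qv' (step_incl u) = qv u.
Proof. by rewrite /qval /= step_val_incl. Qed.

Definition stable_letter : F' := free_gen None.
Local Notation X := stable_letter.

Lemma step_val_stable : V' X = x.
Proof. exact: free_lift_gen. Qed.

Lemma qv_stable_zpow a : qv' (zpow X a) = px a.
Proof. by rewrite !gmulf_zpow /= /qval /= step_val_stable. Qed.

Variables (dq : Q -> Q) (da : Q -> int).
Hypothesis dqP : forall q b, inH q ->
  dq (q * px b) = q * qv (carry b) /\ da (q * px b) = (b %% d)%Z.

(** These values are forced by [step_sec]: moving [x^a] past [z] conjugates [z], and multiplying
    [x^a] by [x] leaves a carry in [H] when the exponent wraps round. *)
Definition step_push (q : Q) (o : option Z) : free_group (gens P) :=
  if o is Some z then Phi (dq q) (int_conj (da q) (free_gen z))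
  else Phi (dq q) (carry (da q + 1)).

Definition step_sec (q : Q) : G := s (dq q) * zpow x (da q).

Variable Phi' : Q -> F' -> free_group (gens P).
Hypothesis Phi'M : crossed qv' Phi'.
Hypothesis Phi'_gen : forall q z, Phi' q (free_gen z) = step_push q z.

Lemma fibre_reduced q a : inH q -> (a %% d)%Z = a ->
  dq (q * px a) = q /\ da (q * px a) = a.
Proof.
move=> Hq ar; have [-> ->] := dqP a Hq.
by rewrite carry_reduced // gmulf1 mulg1.
Qed.

Lemma step_push_incl q a u : inH q -> (a %% d)%Z = a ->
  Phi' (q * px a) (step_incl u) = Phi q (int_conj a u).
Proof.
move=> Hq ar; move: q u Hq.
apply: (@crossed_eq _ _ _ (qval p v) inH
  (fun q u => Phi' (q * px a) (step_incl u)) (fun q u => Phi q (int_conj a u))).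
- move=> q u w; rewrite gmulfM Phi'M /= qv_step_incl.
  by rewrite -[q * px a * _]mulgA [px a * _]Qab mulgA.
- by move=> q u w; rewrite gmulfM PhiM /= qv_int_conj.
- exact: inH_mul.
move=> q z Hq; rewrite step_incl_gen Phi'_gen /=.
by have [-> ->] := fibre_reduced Hq ar.
Qed.

(** Each letter [x] contributes the quotient of two consecutive carries, and these quotients
    telescope. *)
Lemma step_push_stable q a b : inH q ->
  Phi' (q * px a) (zpow X b) = (Phi q (carry a))^-1 * Phi q (carry (a + b)).
Proof.
move=> Hq.
have one a' : Phi' (q * px a') X = (Phi q (carry a'))^-1 * Phi q (carry (a' + 1)).
  rewrite Phi'_gen /=; have [-> ->] := dqP a' Hq.
  by rewrite (carryS a') PhiM mulKg.
elim/int_rect: b => [|n IHn|n IHn].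
- by rewrite zpow0 (crossed1 Phi'M) addr0 mulVg.
- rewrite -addn1 PoszD zpowS Phi'M IHn /= qv_stable_zpow -(mulgA q) -gmulfM -zpowD.
  by rewrite one addrA mulgA mulgK.
have qX : (qv' X)^-1 = px (-1)%R by rewrite zpowN gmulfV -(qv_stable_zpow 1) zpow1.
rewrite -addn1 PoszD opprD zpowD Phi'M IHn (zpowN X 1) zpow1 (crossedV Phi'M) /=.
rewrite qv_stable_zpow qX -!(mulgA q) -!gmulfM -!zpowD one.
by rewrite !addrA addrNK invgM invgK !mulgA mulgK.
Qed.

Lemma stable_zpow_position q a b : q * px a * qv' (zpow X b) = q * px (a + b).
Proof. by rewrite qv_stable_zpow -mulgA -gmulfM -zpowD. Qed.

Lemma incl_position q a u : q * px a * qv' (step_incl u) = q * qv u * px a.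
Proof. by rewrite qv_step_incl -!mulgA [px a * _]Qab. Qed.

(** Expresses the pushed conjugation relator through the old [Phi], at a word over [H] that depends
    on [a]; what remains is to control that word as [a] grows. *)
Lemma step_push_conj q a b g : inH q -> (a %% d)%Z = a ->
  Phi' (q * px a) (zpow X b * step_incl g * zpow X (- b) *
                   (step_incl (int_conj b g))^-1)
  = Phi q (carry (a + b) * int_conj ((a + b) %% d)%Z g * (carry (a + b))^-1 *
           (int_conj a (int_conj b g))^-1).
Proof.
move=> Hq ar; rewrite !Phi'M !PhiM !gmulfM /= !(mulgA (q * px a)) !(mulgA q).
rewrite !(stable_zpow_position, incl_position) addrK -!gmulfV.
rewrite (step_push_stable _ _ Hq) (step_push_stable _ _ (inH_mul g Hq)).
rewrite (step_push_incl _ (inH_mul g Hq) ar).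
have -> : q * px (a + b) = q * qv (carry (a + b)) * px ((a + b) %% d)%Z.
  by rewrite -mulgA -px_carry.
rewrite (step_push_incl _ (inH_mul _ Hq)) ?modz_mod //.
rewrite addrK (carry_reduced ar) !(crossed1 PhiM) invg1 mul1g mulg1.
rewrite qv_int_conj.
have cancel t : q * qv t * qv g * (qv t)^-1 = q * qv g.
  by rewrite -(mulgA q) [qv t * _]Qab mulgA mulgK.
congr (_ * _ * _ * _).
  by rewrite (crossedV PhiM) /= cancel.
by rewrite [qv (carry _)^-1]gmulfV /= cancel.
Qed.

Lemma step_push_pow q a : inH q -> (a %% d)%Z = a ->
  Phi' (q * px a) (zpow X d * (step_incl c)^-1) = Phi q (c * (int_conj a c)^-1).
Proof.
move=> Hq ar; rewrite Phi'M PhiM /= stable_zpow_position step_push_stable //.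
rewrite carryDd // carry_reduced // (crossed1 PhiM) invg1 mul1g; congr (_ * _).
have -> : q * px (a + d) = q * qv c * px a.
  by rewrite addrC zpowD gmulfM mulgA /qval /= cP.
by rewrite -gmulfV step_push_incl ?gmulfV //; apply: inH_mul.
Qed.

(** * Exponential control of words that are trivial in the subgroup *)

Definition qball (L : nat) (u : F) : Prop :=
  exists w : word Z, (size w <= L)%N /\ qv u = qv (free_of_word w).

(** One constant bounds both the number of factors and the radius, so that the predicate is monotone
    in it and [uniform_bound] applies. *)
Definition ball_null C u := nprod (rel_conj rl (qball C)) C u.

Lemma qball_leq L L' u : (L <= L')%N -> qball L u -> qball L' u.
Proof. by move=> le [w [sw qw]]; exists w; split=> //; apply: leq_trans le. Qed.

Lemma ball_nprod_leq L L' k k' u : (L <= L')%N -> (k <= k')%N ->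
  nprod (rel_conj rl (qball L)) k u -> nprod (rel_conj rl (qball L')) k' u.
Proof.
move=> leL lek /(nprod_leq lek); apply: nprod_sub => t.
by apply: rel_conj_sub => y; apply: qball_leq.
Qed.

Lemma ball_null_exists u : V u = 1 -> exists C, ball_null C u.
Proof.
move=> /(push_ker push)[k]; elim=> {k u} [k|k _ u [t [r [_ rl_r ->]]] _ [C IHu]].
  by exists 0%N; apply: nprod1.
exists (1 + (size (free_word t) + C))%N; rewrite /ball_null; apply: nprod_mul.
  exists t, r; split=> //; exists (free_word t); rewrite free_wordK; split=> //.
  by rewrite addnCA leq_addr.
apply: ball_nprod_leq IHu; last exact: leq_addl.
exact: leq_trans (leq_addl _ _) (leqnSn _).
Qed.

(** One application of [h] turns each relator into at most [C] conjugates of relators and, as [h]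
    preserves images in [Q], moves the conjugators by at most [C]: counts multiply while radii
    add. *)
Lemma iter_conj_bound (h : UMagmaMorphism.type F F) u :
  (forall w, qv (h w) = qv w) -> (forall w, V w = 1 -> V (h w) = 1) ->
  V u = 1 -> exists2 C, (0 < C)%N &
    forall n, nprod (rel_conj rl (qball (C * n.+1))) (C ^ n.+1) (iter_morph h n u).
Proof.
move=> hq hV Vu; have [C0 uC0] := ball_null_exists Vu.
have [C1 hC1] : exists C1, {in rl, forall r, ball_null C1 (h (free_of_word r))}.
  apply: uniform_bound => [m n r lemn|r rl_r]; first exact: ball_nprod_leq.
  by apply/ball_null_exists/hV/push_relator; rewrite /is_relator rl_r.
pose C := maxn C0 C1.+1.
have leC0 : (C0 <= C)%N by apply: leq_maxl.
have leC1 : (C1 <= C)%N by apply: leq_trans (leqnSn _) (leq_maxr _ _).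
exists C => [|n]; first by rewrite (leq_trans (ltn0Sn C1)) ?leq_maxr.
elim: n => [|n IHn].
  by rewrite muln1 expn1; apply: ball_nprod_leq uC0.
rewrite expnSr /iter_morph iterS.
apply: nprod_morph IHn => _ [t [r [[w [sw qw]] rl_r ->]]].
rewrite !gmulfM gmulfV.
have h_r : nprod (rel_conj rl (qball C1)) C (h (free_of_word r)).
  apply: (nprod_leq leC1); move: r rl_r.
  apply: (is_relator_ind (P := fun y => ball_null C1 (h y))) => [y|r /hC1//].
  by rewrite gmulfV; apply: nprodV => y'; apply: rel_conjV.
apply: nprod_conj h_r => y; apply: rel_conjJ => y' [w' [sw' qw']].
exists (w ++ w'); rewrite size_cat mulnS addnC leq_add ?(leq_trans sw') //.
by split=> //; rewrite free_of_word_cat !gmulfM /= hq qw qw'.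
Qed.

(* Only the a that occur in normal forms q x^a matter: finitely many if d > 0. *)
Definition exp_null (W : int -> F) : Prop := exists2 C, (0 < C)%N &
  forall a, (a %% d)%Z = a ->
    nprod (rel_conj rl (qball (C * `|a|.+1))) (C ^ `|a|.+1) (W a).

Lemma exp_null_conj u : V u = 1 -> exp_null (fun a => int_conj a u).
Proof.
move=> Vu; have [||C C0 uC] := @iter_conj_bound bp u _ _ Vu.
- by move=> w; apply: (qv_int_conj 1).
- by move=> w Vw; rewrite bpP Vw mulg1 mulgV.
have [||C' C'0 uC'] := @iter_conj_bound bm u _ _ Vu.
- by move=> w; apply: (qv_int_conj (-1)).
- by move=> w Vw; rewrite bmP Vw mulg1 mulVg.
exists (C + C')%N => [|a _]; first by rewrite addn_gt0 C0.
case: a => n /=.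
  by apply: ball_nprod_leq (uC n); rewrite ?leq_mul2r ?leq_exp2r ?leq_addr ?orbT.
apply: ball_nprod_leq (uC' n.+1); rewrite ?leq_mul2r ?leq_exp2r ?leq_addl ?orbT //.
Qed.

Lemma exp_null_finite W : (0 < d)%N -> (forall a, V (W a) = 1) -> exp_null W.
Proof.
move=> d0 VW.
have [C CW] : exists C, {in iota 0 d, forall n, ball_null C (W (Posz n))}.
  apply: uniform_bound => [m n r lemn|n _]; first exact: ball_nprod_leq.
  exact: ball_null_exists.
exists C.+1 => // a ar.
have [n ltnd defa] : exists2 n, (n < d)%N & a = n.
  have a_ge0 : (0 <= a)%R by rewrite -ar modz_ge0 // eqz_nat -lt0n.
  exists `|a|%N; last by rewrite gez0_abs.
  by rewrite -ltz_nat gez0_abs // -ar ltz_pmod.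
rewrite defa; apply: ball_nprod_leq (CW n _); last by rewrite mem_iota.
  by rewrite (leq_trans (leqnSn C)) // leq_pmulr.
by rewrite expnS (leq_trans (leqnSn C)) // leq_pmulr // expn_gt0.
Qed.

(** For [d > 0] finitely many exponents occur. For [d = 0] there is no carry, and the word is
    trivial unless [a] and [b] have opposite signs; then it is an iterated conjugate of the defect
    between [g] and [bm (bp g)] or [bp (bm g)]. *)
Lemma exp_null_relator g b : (b == 1)%R || (b == -1)%R ->
  exp_null (fun a => carry (a + b) * int_conj ((a + b) %% d)%Z g *
                     (carry (a + b))^-1 * (int_conj a (int_conj b g))^-1).
Proof.
move=> b1; have [d_eq0|d_gt0] := posnP d; last first.
  apply: exp_null_finite => // a; rewrite !gmulfM !gmulfV /= !int_conjP.
  rewrite !mulgA -zpow_carry zpowD.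
  have -> : zpow x a * zpow x b * V g * (zpow x ((a + b) %% d)%Z)^-1 *
      (V (carry (a + b)))^-1 = zpow x a * zpow x b * V g * (zpow x (a + b))^-1.
    by rewrite (zpow_carry (a + b)) invgM !mulgA.
  by rewrite zpowD !invgM !invgK !mulgA !(mulgVK, mulgK) mulgV.
have red a : carry (a + b) = 1 by rewrite /carry d_eq0 divz0.
have redm a : ((a + b) %% d)%Z = (a + b)%R by rewrite d_eq0 modz0.
pose E (h h' : UMagmaMorphism.type F F) := g * (h (h' g))^-1.
have VE1 : V (E bm bp) = 1.
  by rewrite gmulfM gmulfV /= bmP bpP !mulgA mulVg mul1g mulgVK mulgV.
have VE2 : V (E bp bm) = 1.
  by rewrite gmulfM gmulfV /= bpP bmP !mulgA mulgV mul1g mulgK mulgV.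
have [C C0 CE1] := exp_null_conj VE1; have [C' C'0 CE2] := exp_null_conj VE2.
exists (C + C')%N => [|a ar]; first by rewrite addn_gt0 C0.
rewrite red redm mul1g invg1 mulg1.
case/orP: b1 => /eqP -> {b red redm}; case: a ar => n ar.
- have -> : int_conj (Posz n + 1)%R g = int_conj n (int_conj 1 g).
    by rewrite -PoszD addn1 /int_conj /iter_morph iterSr.
  by rewrite mulgV; apply: nprod1.
- have -> : (Negz n + 1 = - (n : int))%R by rewrite NegzE -addn1 PoszD opprD addrNK.
  have -> : int_conj (Negz n) (int_conj 1 g) = int_conj (- (n : int)) (bm (bp g)).
    by case: n {ar} => // n; rewrite -NegzE /int_conj /iter_morph [in LHS]iterSr.
  rewrite -gmulfV -gmulfM; have := CE1 (- (n : int))%R.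
  rewrite d_eq0 modz0 => /(_ erefl).
  apply: ball_nprod_leq; rewrite abszN /=.
    by apply: leq_mul; rewrite ?leq_addr.
  apply: (@leq_trans ((C + C') ^ n.+1)); first by rewrite leq_exp2r ?leq_addr.
  by rewrite leq_pexp2l ?addn_gt0 ?C0.
- case: n {ar} => [|n]; first by rewrite add0r mulgV; apply: nprod1.
  have -> : (Posz n.+1 + - 1 = n)%R by rewrite -addn1 PoszD addrK.
  have -> : int_conj n.+1 (int_conj (-1) g) = int_conj n (bp (bm g)).
    by rewrite /int_conj /iter_morph iterSr.
  rewrite -gmulfV -gmulfM; have := CE2 n; rewrite d_eq0 modz0 => /(_ erefl).
  apply: ball_nprod_leq => /=; first by apply: leq_mul; rewrite ?leq_addl.
  apply: (@leq_trans ((C + C') ^ n.+1)); first by rewrite leq_exp2r ?leq_addl.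
  by rewrite leq_pexp2l ?addn_gt0 ?C0.
have -> : int_conj (Negz n - 1)%R g = int_conj (Negz n) (int_conj (-1) g).
  have -> : (Negz n - 1 = Negz n.+1)%R by rewrite !NegzE -[in RHS]addn1 PoszD opprD.
  by rewrite /int_conj /iter_morph iterSr.
by rewrite mulgV; apply: nprod1.
Qed.

(** In the abelian group [Q] all stable letters can be collected on the right. *)
Lemma fibre_position_split (w : word (option Z)) : exists w1 b,
  [/\ (size w1 <= size w)%N, (`|b| <= size w)%N &
      qv' (free_of_word w) = qv (free_of_word w1) * px b].
Proof.
elim: w => [|[o e] w [w1 [b [sw1 leb qw]]]].
  by exists [::], 0%R; rewrite !free_of_word_nil !gmulf1 mulg1.
rewrite free_of_word_cons gmulfM /= qw; case: o => [z|].
  exists ((z, e) :: w1), b; split=> //; first exact: leqW.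
  rewrite free_of_word_cons gmulfM /= mulgA; congr (_ * _ * _).
  by case: e; rewrite ?gmulfV /= -(step_incl_gen z) -qv_step_incl.
exists w1, (b + (-1) ^+ e)%R; split; first exact: leqW.
  apply: leq_trans (absz_leqD _ _) _; rewrite absz_sign addn1.
  exact: leb.
rewrite zpowD gmulfM [RHS]mulgA [LHS]Qab; congr (_ * _).
have qX : qv' X = px 1 by rewrite -qv_stable_zpow zpow1.
by case: e; rewrite -[free_gen None]/stable_letter ?gmulfV /= qX // -gmulfV -zpowN.
Qed.

Lemma free_word_zpow (u : F) (k : int) :
  exists w, (size w <= size (free_word u) * `|k|)%N /\ free_of_word w = zpow u k.
Proof.
have pos n : exists w,
    (size w <= size (free_word u) * n)%N /\ free_of_word w = u ^+ n.
  elim: n => [|n [w [sw wE]]]; first by exists [::]; rewrite muln0.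
  exists (free_word u ++ w); rewrite size_cat mulnS leq_add2l sw; split=> //.
  by rewrite free_of_word_cat free_wordK wE expgS.
case: k => n; first exact: pos.
have [w [sw wE]] := pos n.+1; exists (inv_word w).
by rewrite size_inv_word free_of_word_inv wE.
Qed.

Lemma fibre_position : exists K, forall w : word (option Z), exists w0 a,
  [/\ (size w0 <= K * (size w).+1)%N, (`|a|.+1 <= K * (size w).+1)%N,
      (a %% d)%Z = a & qv' (free_of_word w) = qv (free_of_word w0) * px a].
Proof.
(* The summands pay for the letters of [w], for the copies of [c] in the carry and, if [d > 0], for
   the remainder modulo [d]. *)
exists (1 + size (free_word c) + d)%N => w.
have [w1 [b [sw1 leb qw]]] := fibre_position_split w.
have [w2 [sw2 w2E]] := free_word_zpow c (b %/ d)%Z.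
have le_div : (`|(b %/ d)%Z| <= size w)%N.
  apply: leq_trans leb; rewrite /divz; case: b {qw sw2 w2E} => n; rewrite abszM.
    by case: (d) => [|d'] //=; rewrite mul1n leq_div.
  by case: (d) => [|d'] //=; rewrite mul1n ltnS leq_div.
exists (w1 ++ w2), (b %% d)%Z; split; last 2 first.
- exact: modz_mod.
- by rewrite qw px_carry mulgA -gmulfM free_of_word_cat w2E.
- rewrite size_cat !mulnDl mul1n -addnA leq_add ?(leq_trans sw1) //.
  rewrite (leq_trans sw2) // (leq_trans _ (leq_addr _ _)) // leq_mul2l.
  by rewrite (leq_trans le_div) ?orbT.
have le_mod : (`|(b %% d)%Z| <= `|b| + d)%N.
  have [d_eq0|d_gt0] := posnP d; first by rewrite d_eq0 modz0 leq_addr.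
  rewrite (leq_trans _ (leq_addl _ _)) // ltnW // -ltz_nat gez0_abs ?ltz_pmod //.
  by rewrite modz_ge0 // eqz_nat -lt0n.
rewrite !mulnDl mul1n addnAC (leq_trans _ (leq_addr _ _)) //.
rewrite addSn ltnS (leq_trans le_mod) // leq_add //.
by rewrite mulnS leq_addr.
Qed.

Lemma exp_null_push W : exp_null W -> exists2 A, (0 < A)%N &
  forall w : word (option Z), exists q a,
    [/\ inH q, (a %% d)%Z = a, qv' (free_of_word w) = q * px a &
        nprod null_conj (A ^ (size w).+1) (Phi q (W a))].
Proof.
case=> C C0 CW; have [K KP] := fibre_position.
have [A0 A0P] : exists A0, {in rl, forall r, forall w,
    nprod null_conj (A0.+1 ^ (size w).+1)
      (Phi (qv (free_of_word w)) (free_of_word r))}.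
  apply: uniform_bound => [m n r lemn mP w|r rl_r].
    by apply: nprod_leq (mP w); rewrite leq_exp2r.
  have [|A A0 AP] := push_bound push (x := free_of_word r).
    by apply: push_relator; rewrite /is_relator rl_r.
  by exists A.-1 => w; rewrite prednK.
set A := A0.+1 in A0P.
have qv_rel r : is_relator rl r -> qv (free_of_word r) = 1.
  by move=> /push_relator; rewrite /qval /= => ->; apply: gmulf1.
have AP r w : is_relator rl r ->
    nprod null_conj (A ^ (size w).+1)
      (Phi (qv (free_of_word w)) (free_of_word r)).
  move=> rl_r; case/orP: (rl_r) => [/A0P//|/A0P rP].
  rewrite -[r]inv_wordK free_of_word_inv (crossedV PhiM) /=.
  rewrite (qv_rel (inv_word r)) ?is_relatorV // invg1 mulg1.
  by apply: nprodV (rP w) => t; apply: rel_conjV.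
(* [C ^ K] accounts for the number of conjugates and the power of [A] for the cost of each, read
   from a position of length at most [size w0 + C * |a|.+1]. Both exponents are linear in the size
   of [w]. *)
exists (C ^ K * A ^ (K + C * K + 1))%N => [|w].
  by rewrite muln_gt0 !expn_gt0 C0.
have [w0 [a [sw0 le_a ar qw]]] := KP w.
exists (qv (free_of_word w0)), a; split=> //; first by exists (free_of_word w0).
rewrite expnMn -!expnM.
apply: (@nprod_leq _ _ (C ^ `|a|.+1 * A ^ (size w0 + C * `|a|.+1).+1)).
  apply: leq_mul; first by rewrite leq_pexp2l.
  rewrite leq_pexp2l // !mulnDl mul1n -addn1 leq_add // leq_add //.
  by rewrite -mulnA leq_mul2l le_a orbT.
have qker t : rel_conj rl (qball (C * `|a|.+1)) t -> qv t = 1.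
  by case=> u [r [_ rl_r ->]]; rewrite !gmulfM gmulfV /= qv_rel // mulg1 mulgV.
apply: nprod_map (CW a ar) => [|t y /qker qt|_ [u [r [[wu [swu qu]] rl_r ->]]]].
- exact: crossed1.
- by rewrite PhiM /= qt mulg1.
rewrite (crossedJ PhiM) /=; last exact: qv_rel.
apply: nprod_any_conjJ.
rewrite qu -gmulfM -free_of_word_cat; apply: nprod_leq (AP r _ rl_r).
by rewrite leq_pexp2l // ltnS size_cat leq_add2l.
Qed.

(** The presentation of an extension by a cyclic group: the power relation, the old relators and the
    action of the stable letter. Both signs of [b] occur because [bp] and [bm] are chosen
    independently. *)
Definition step_relators : seq (word (option Z)) :=
  free_word (zpow X d * (step_incl c)^-1) ::
  [seq free_word (step_incl (free_of_word r)) | r <- rl] ++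
  [seq free_word (zpow X b * step_incl (free_gen z) * zpow X (- b) *
                  (step_incl (int_conj b (free_gen z)))^-1)
     | b <- [:: 1%R; (-1)%R] : seq int, z <- enum Z].

Lemma step_relator_cases (Pr : F' -> Prop) :
  Pr (zpow X d * (step_incl c)^-1) ->
  (forall r, r \in rl -> Pr (step_incl (free_of_word r))) ->
  (forall z b, (b == 1)%R || (b == -1)%R ->
     Pr (zpow X b * step_incl (free_gen z) * zpow X (- b) *
         (step_incl (int_conj b (free_gen z)))^-1)) ->
  forall r, r \in step_relators -> Pr (free_of_word r).
Proof.
move=> Pd Prl Pz r; rewrite inE mem_cat => /or3P[/eqP->|/mapP[r0 rl_r0 ->]|].
- by rewrite free_wordK.
- by rewrite free_wordK; apply: Prl.
case/allpairsP=> -[b z] [b1 _ ->]; rewrite free_wordK; apply: Pz.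
by rewrite !inE in b1.
Qed.

Lemma step_relator_val r : is_relator step_relators r -> V' (free_of_word r) = 1.
Proof.
move: r; apply: (is_relator_ind (P := fun y => V' y = 1)) => [y yE|].
  by rewrite gmulfV /= yE invg1.
apply: (step_relator_cases (Pr := fun y => V' y = 1)) => [|r rl_r|z b _].
- rewrite gmulfM gmulfV gmulf_zpow /= step_val_stable step_val_incl cP mulgV //.
- by rewrite step_val_incl push_relator // /is_relator rl_r.
rewrite !gmulfM gmulfV !gmulf_zpow /= step_val_stable !step_val_incl int_conjP.
by rewrite zpowN mulgV.
Qed.

Lemma step_relator_bound r : r \in step_relators -> exists2 A, (0 < A)%N &
  forall w, nprod null_conj (A ^ (size w).+1)
    (Phi' (qv' (free_of_word w)) (free_of_word r)).
Proof.
move: r; apply: (step_relator_cases (Pr := fun y => exists2 A, (0 < A)%N &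
  forall w, nprod null_conj (A ^ (size w).+1) (Phi' (qv' (free_of_word w)) y))).
- have : exp_null (fun a => c * (int_conj a c)^-1).
    have [d0|d_gt0] := posnP d.
      exists 1%N => // a _; rewrite c0 // gmulf1 mulgV; exact: nprod1.
    apply: exp_null_finite => // a; rewrite gmulfM gmulfV /= int_conjP cP.
    by rewrite -zpowD addrC zpowD mulgK mulgV.
  case/exp_null_push=> A A0 AP; exists A => // w.
  by have [q [a [Hq ar -> AW]]] := AP w; rewrite step_push_pow.
- move=> r rl_r; have Vr : V (free_of_word r) = 1.
    by apply: push_relator; rewrite /is_relator rl_r.
  have [A A0 AP] := exp_null_push (exp_null_conj Vr); exists A => // w.
  by have [q [a [Hq ar -> AW]]] := AP w; rewrite step_push_incl.
move=> z b b1; have [A A0 AP] := exp_null_push (exp_null_relator (free_gen z) b1).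
exists A => // w; have [q [a [Hq ar -> AW]]] := AP w.
by rewrite step_push_conj.
Qed.

(** Congruence in the group presented by the new relators, where normal forms are computed before
    passing to [G]. *)
Local Notation "u =~ w" := (eqv_mod step_relators u w) (at level 70).

Lemma stable_conj a u :
  zpow X a * step_incl u * zpow X (- a) =~ step_incl (int_conj a u).
Proof.
have conjM b (t t' : F') : (zpow X b * t * zpow X (- b)) *
    (zpow X b * t' * zpow X (- b)) = zpow X b * (t * t') * zpow X (- b).
  by rewrite zpowN !mulgA mulgVK.
have conjV b (t : F') : (zpow X b * t * zpow X (- b))^-1 =
    zpow X b * t^-1 * zpow X (- b).
  by rewrite zpowN !invgM invgK !mulgA.
have step1 b w : (b == 1)%R || (b == -1)%R ->
    zpow X b * step_incl w * zpow X (- b) =~ step_incl (int_conj b w).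
  move=> b1; move: w; apply: free_ind => [|z w IHw|z w IHw].
  - by rewrite !gmulf1 mulg1 zpowN mulgV; apply: eqv_mod_refl.
  - rewrite !gmulfM -(conjM b); apply: eqv_modM IHw; apply: eqv_mod_relator.
    rewrite inE mem_cat; apply/or3P/Or33.
    by apply/allpairsP; exists (b, z); rewrite mem_enum !inE.
  rewrite !gmulfM !gmulfV -(conjM b) -conjV; apply: eqv_modM IHw.
  apply/eqv_modV/eqv_mod_relator; rewrite inE mem_cat; apply/or3P/Or33.
  by apply/allpairsP; exists (b, z); rewrite mem_enum !inE.
have iter_step b n w : (b == 1)%R || (b == -1)%R ->
    zpow X (b * n%:Z)%R * step_incl w * zpow X (- (b * n%:Z)%R) =~
      step_incl (iter n (int_conj b) w).
  move=> b1; elim: n => [|n IHn].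
    by rewrite mulr0 oppr0 zpow0 mul1g mulg1; apply: eqv_mod_refl.
  rewrite iterS; apply: eqv_mod_trans (step1 b _ b1).
  have -> : zpow X (b * n.+1)%R * step_incl w * zpow X (- (b * n.+1)%R) =
      zpow X b * (zpow X (b * n)%R * step_incl w * zpow X (- (b * n)%R)) *
      zpow X (- b).
    have -> : (b * n.+1 = b + b * n)%R by rewrite -addn1 PoszD mulrDr mulr1 addrC.
    by rewrite opprD (addrC (- b)%R) !zpowD !mulgA.
  by apply: eqv_modM; [apply: eqv_modM => //|]; apply: eqv_mod_refl.
case: a => n; first by have := iter_step 1%R n u isT; rewrite mul1r.
by have := iter_step (-1)%R n.+1 u isT; rewrite mulN1r -NegzE.
Qed.

Lemma stable_normal_form y : exists a u, y =~ zpow X a * step_incl u.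
Proof.
have incl w a u : step_incl w * (zpow X a * step_incl u) =~
    zpow X a * step_incl (int_conj (- a) w * u).
  rewrite gmulfM mulgA mulgA; apply: eqv_modM; last exact: eqv_mod_refl.
  have := stable_conj (- a) w; rewrite opprK.
  move=> /(eqv_modM (eqv_mod_refl step_relators (zpow X a))).
  by rewrite zpowN !mulgA mulgV mul1g.
have shift b a u : zpow X b * (zpow X a * step_incl u) =~ zpow X (b + a) * step_incl u.
  by rewrite zpowD mulgA; apply: eqv_mod_refl.
move: y; apply: free_ind => [|[z|] y [a [u yE]]|[z|] y [a [u yE]]].
- by exists 0%R, 1; rewrite gmulf1 mulg1; apply: eqv_mod_refl.
- exists a, (int_conj (- a) (free_gen z) * u); apply: eqv_mod_trans (incl _ _ _).
  by rewrite step_incl_gen; apply: eqv_modM yE; apply: eqv_mod_refl.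
- exists (1 + a)%R, u; apply: eqv_mod_trans (shift _ _ _).
  by apply: eqv_modM yE; apply: eqv_mod_refl.
- exists a, (int_conj (- a) (free_gen z)^-1 * u); apply: eqv_mod_trans (incl _ _ _).
  by rewrite gmulfV /= step_incl_gen; apply: eqv_modM yE; apply: eqv_mod_refl.
exists (-1 + a)%R, u; apply: eqv_mod_trans (shift _ _ _).
by rewrite zpowN; apply: eqv_modM yE; apply: eqv_mod_refl.
Qed.

Lemma step_val_null k y : nprod (any_conj step_relators) k y -> V' y = 1.
Proof.
apply: nprod_ker => _ [u [r [_ /step_relator_val vr ->]]].
by rewrite !gmulfM /= vr mulg1 -gmulfM mulgV gmulf1.
Qed.

(** Modulo the relators [y] is [X^a u] with [u] over [H]. If [y] is trivial in [G], then [d] divides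
    [a], the power relation replaces [X^a] by a power of [c], and the old presentation handles the
    resulting word over [H]. *)
Lemma step_ker y : V' y = 1 <-> exists k, nprod (any_conj step_relators) k y.
Proof.
split=> [Vy|[k]]; last exact: step_val_null.
suff [k] : y =~ 1 by rewrite invg1 mulg1; exists k.
have [a [u yE]] := stable_normal_form y.
have Vau : zpow x a * V u = 1.
  have [k /step_val_null] := yE; rewrite gmulfM gmulfV /= Vy mul1g => E.
  apply: invg_inj; rewrite invg1 -E.
  by rewrite gmulfM gmulf_zpow /= step_val_stable step_val_incl.
have /dP/dvdzP[k defa] : exists t, V t = zpow x a.
  exists u^-1; rewrite gmulfV /=; apply/mulg1_eq/(mulgI (zpow x a)).
  by rewrite mulgA Vau mul1g mulg1.
apply: eqv_mod_trans yE _.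
apply: (@eqv_mod_trans _ _ (step_incl (zpow c k * u))).
  rewrite gmulfM; apply: eqv_modM (eqv_mod_refl _ _).
  rewrite defa mulrC zpowM gmulf_zpow; apply/eqv_mod_zpow/eqv_mod_relator.
  exact: mem_head.
have : V (zpow c k * u) = 1 by rewrite gmulfM gmulf_zpow /= cP -zpowM mulrC -defa.
move=> /(push_ker push)[l Rl]; exists (l * 1)%N; rewrite invg1 mulg1.
apply: nprod_morph Rl => _ [w [r [_ rl_r ->]]]; rewrite !gmulfM gmulfV.
apply: nprod_any_conjJ; move: r rl_r.
apply: (is_relator_ind (P := fun t => nprod _ 1 (step_incl t))) => [t|r rl_r].
  by rewrite gmulfV; apply: nprodV => t'; apply: rel_conjV.
apply: nprod_gen; exists 1, (free_word (step_incl (free_of_word r))).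
rewrite free_wordK mul1g invg1 mulg1; split=> //.
apply/orP; left; rewrite inE mem_cat; apply/or3P/Or32.
by apply/mapP; exists r.
Qed.

Lemma pushdown_step_aux : pushdown i p step_val step_relators Phi' step_sec.
Proof.
split.
- exact: step_ker.
- move=> n; have [u Vu] := push_normal push n.
  by exists (step_incl u); rewrite step_val_incl.
- exact: Phi'M.
- have [dq1 da1] := fibre_reduced (a := 0%R) inH1 (mod0z d).
  have px0 : px 0%R = 1 by apply: gmulf1.
  rewrite px0 mulg1 in dq1 da1.
  by rewrite /step_sec dq1 da1 (push_sec1 push) mulg1.
- move=> q y [u ->].
  have inH' : exists q0 a, [/\ inH q0, (a %% d)%Z = a & qv' u = q0 * px a].
    have [K KP] := fibre_position; have [w0 [a [_ _ ar qu]]] := KP (free_word u).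
    exists (qv (free_of_word w0)), a.
    by split=> //; [exists (free_of_word w0)|rewrite -qu free_wordK].
  (* Both sides of the section identity are crossed, so they are compared on generators, at the
     positions that have a normal form. *)
  pose I q := exists q0 a, [/\ inH q0, (a %% d)%Z = a & q = q0 * px a].
  move: (qv' u) y inH' => {}q y; rewrite -/(I q).
  apply: (@crossed_eq _ _ _ qv' I (fun q y => i (pres_val (Phi' q y)))
    (fun q y => step_sec q * V' y * (step_sec (q * qv' y))^-1)).
  + by move=> {}q t t'; rewrite Phi'M !gmulfM.
  + by move: step_sec => sc {}q t t'; rewrite !gmulfM /= !mulgA mulgVK.
  + move=> {}q t [q0 [a [Hq ar ->]]].
    have [K KP] := fibre_position; have [w [b [_ _ _ tE]]] := KP (free_word t).
    rewrite free_wordK in tE; rewrite /= tE mulgA -(mulgA q0) [px a * _]Qab.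
    exists (q0 * qv (free_of_word w) * qv (carry (a + b))), ((a + b) %% d)%Z.
    split; rewrite ?modz_mod //; first by do 2! apply: inH_mul.
    by rewrite -!mulgA -px_carry -gmulfM -zpowD.
  move=> {}q o [q0 [a [Hq ar ->]]]; rewrite Phi'_gen free_lift_gen.
  have [dq0 da0] := fibre_reduced Hq ar.
  case: o => [z|]; rewrite /= dq0 da0 (push_sec push) // /step_sec dq0 da0.
    rewrite -step_incl_gen incl_position.
    have [-> ->] := fibre_reduced (inH_mul (free_gen z) Hq) ar.
    by rewrite qv_int_conj int_conjP free_lift_gen invgM !mulgA.
  rewrite -[free_gen None]/X -[t in qv' t]zpow1 stable_zpow_position.
  have [-> ->] := dqP (a + 1)%R Hq.
  by rewrite -(mulgA _ _ x) -zpowS zpow_carry invgM !mulgA mulgK.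
move=> y /step_ker[k]; move: k y.
exact: push_bound_from_relators Phi'M step_relator_val step_relator_bound.
Qed.

End Step.

(** * Climbing from N to G *)

Section Tower.
Variables (N G Q : groupType).
Variables (i : UMagmaMorphism.type N G) (p : UMagmaMorphism.type G Q).
Hypothesis i_inj : injective i.
Hypothesis exact_G : forall x, p x = 1 <-> exists y, i y = x.
Hypothesis Qab : forall x y : Q, x * y = y * x.
Variable P : finite_presentation N.

Lemma pushdown_step (Z : finType) (v : Z -> G) rl Phi s (x : G) :
  @pushdown N G Q i p P Z v rl Phi s ->
  exists rl' Phi' s', @pushdown N G Q i p P _ (step_val v x) rl' Phi' s'.
Proof.
move=> push; have [d dP] := order_mod_exists v x.
have [c cP c0] : exists2 c, free_lift v c = zpow x d & d = 0%N -> c = 1.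
  have [d0|d0] := eqVneq d 0%N; first by exists 1; rewrite ?d0 ?gmulf1.
  have [c cP] : exists u, free_lift v u = zpow x d by apply/dP.
  by exists c => // d1; rewrite d1 eqxx in d0.
have [bp bpP] := conj_lift_exists exact_G Qab push x.
have [bm bmP] := conj_lift_exists exact_G Qab push x^-1.
have {}bmP u : free_lift v (bm u) = x^-1 * free_lift v u * x by rewrite bmP invgK.
have [dq [da dqP]] := fibre_decomposition exact_G push dP cP.
have [Phi' Phi'M Phi'_gen] := crossed_exists (qval p (step_val v x))
  (step_push Phi d c bp bm dq da).
exists (step_relators rl d c bp bm), Phi', (step_sec s x dq da).
exact: (pushdown_step_aux Qab push dP cP c0 bpP bmP dqP Phi'M Phi'_gen).
Qed.

(** Used with [l] the values of the generators of [G], so that the last subgroup is [G] itself. *)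
Lemma pushdown_tower (l : seq G) : exists (Z : finType) (v : Z -> G) rl Phi s,
  @pushdown N G Q i p P Z v rl Phi s /\ {in l, forall x, exists z, v z = x}.
Proof.
elim: l => [|x l [Z [v [rl [Phi [s [push vl]]]]]]].
  by do 5!eexists; split; [apply: pushdown_base|].
have [rl' [Phi' [s' push']]] := pushdown_step x push.
exists (option Z), (step_val v x), rl', Phi', s'; split=> // y.
rewrite inE => /predU1P[->|/vl[z <-]]; first by exists None.
by exists (Some z).
Qed.

End Tower.

(** * Comparing areas in N with diagrams over G *)

Section Pushing.
Variables (N G Q : groupType).
Variables (i : UMagmaMorphism.type N G) (p : UMagmaMorphism.type G Q).
Hypothesis i_inj : injective i.
Hypothesis exact_G : forall x, p x = 1 <-> exists y, i y = x.
Hypothesis Qab : forall x y : Q, x * y = y * x.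
Variables (PG : finite_presentation G) (P0 : finite_presentation N).

(* The base A comes from P0 alone, only the constant C depends on P. *)
Lemma area_pushdown : exists A : nat, forall P : finite_presentation N,
  exists C : nat, forall w : word (gens P), null_homotopic w ->
  exists W : word (gens PG), [/\ null_homotopic W, (size W <= C * size w)%N &
    forall D : vk_diagram (rels PG) W,
      (area (rels P) w <= C * (A.+1 ^ vk_radius D * vk_area D) + C * size w)%N].
Proof.
have [Z [v [rl [Phi [s [push vZ]]]]]] :=
  pushdown_tower i_inj exact_G Qab P0 [seq @gen_val G PG x | x <- enum (gens PG)].
have vgen x : exists z, v z = @gen_val G PG x.
  by apply: vZ; apply: map_f; rewrite mem_enum.
have [zx zxP] := choice vgen.
(* [eta] sends generators to generators, so the length of a word, and with it the exponent of the
   bound, is unchanged. *)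
pose eta : UMagmaMorphism.type _ _ := free_lift (fun x => free_gen (zx x)).
have eta_gen x : eta (free_gen x) = free_gen (zx x) by exact: free_lift_gen.
have etaP x : free_lift v (eta x) = pres_val x.
  move: x; apply: free_ind => [|z x IHx|z x IHx]; first by rewrite !gmulf1.
    by rewrite !gmulfM /= IHx eta_gen free_lift_gen zxP pres_val_gen.
  by rewrite !gmulfM !gmulfV /= IHx eta_gen free_lift_gen zxP pres_val_gen.
have PhiM := push_crossed push; pose f x := Phi 1 (eta x).
have qv_eta x : qval p v (eta x) = p (pres_val x) by rewrite /qval /= etaP.
have qv_word t : qval p v (free_of_word [seq (zx a.1, a.2) | a <- t]) =
    p (pres_val (free_of_word t)).
  rewrite -qv_eta; congr (qval p v _).
  elim: t => [|[x e] t IHt]; first by rewrite gmulf1.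
  rewrite /= !free_of_word_cons gmulfM /= IHt; congr (_ * _).
  by case: e; rewrite ?gmulfV /= eta_gen.
have [A AP] : exists A, {in rels PG, forall r, forall w,
    nprod (any_conj (rels P0)) (A.+1 ^ (size w).+1)
      (Phi (qval p v (free_of_word w)) (eta (free_of_word r)))}.
  apply: uniform_bound => [m n r lemn mP w|r PGr].
    by apply: nprod_leq (mP w); rewrite leq_exp2r.
  have [|A A0 AP] := push_bound push (x := eta (free_of_word r)).
    by rewrite etaP pres_val_relator // /is_relator PGr.
  by exists A.-1 => w; rewrite prednK.
have {}AP r : is_relator (rels PG) r -> forall w,
    nprod (any_conj (rels P0)) (A.+1 ^ (size w).+1)
      (Phi (qval p v (free_of_word w)) (eta (free_of_word r))).
  move=> PGr w; case/orP: (PGr) => [/AP//|/AP/(_ w) rP].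
  rewrite -[r]inv_wordK free_of_word_inv gmulfV (crossedV PhiM) /= qv_eta.
  rewrite pres_val_relator ?is_relatorV // gmulf1 invg1 mulg1.
  by apply: nprodV rP => t; apply: rel_conjV.
exists A => P.
have [iota iotaP] := choice (fun y => gen_val_surj PG (i (@gen_val N P y))).
have [psi0 psi0P] := choice (fun y => pres_val_surj P (@gen_val N P0 y)).
pose psi : UMagmaMorphism.type _ _ := free_lift psi0.
pose emb : UMagmaMorphism.type _ _ := free_lift (fun y => free_of_word (iota y)).
have psi_gen y : psi (free_gen y) = psi0 y by exact: free_lift_gen.
have emb_gen y : emb (free_gen y) = free_of_word (iota y) by exact: free_lift_gen.
have psiP x : pres_val (psi x) = pres_val x.
  move: x; apply: free_ind => [|z x IHx|z x IHx]; first by rewrite !gmulf1.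
    by rewrite !gmulfM /= IHx psi_gen psi0P pres_val_gen.
  by rewrite !gmulfM !gmulfV /= IHx psi_gen psi0P pres_val_gen.
have embP x : pres_val (emb x) = i (pres_val x).
  move: x; apply: free_ind => [|z x IHx|z x IHx]; first by rewrite !gmulf1.
    by rewrite !gmulfM /= IHx emb_gen pres_val_word iotaP pres_val_gen.
  by rewrite !gmulfM !gmulfV /= IHx emb_gen pres_val_word iotaP pres_val_gen.
have p_i n : p (i n) = 1 by apply/exact_G; exists n.
(* Pushing a word of [N] through [G] and back is a morphism, as [emb] lands over 1 in [Q], and it
   induces the identity on [N]. Hence [w] and [kappa w] differ by an area linear in the size of
   [w]. *)
pose kappa x := psi (f (emb x)).
have kappaM x y : kappa (x * y) = kappa x * kappa y.
  rewrite /kappa /f !gmulfM PhiM /= qv_eta embP p_i mulg1.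
  by rewrite gmulfM.
have kappa1 : kappa 1 = 1 by rewrite /kappa /f !gmulf1 (crossed1 PhiM) gmulf1.
have kappaV x : kappa x^-1 = (kappa x)^-1.
  by apply: (mulIg (kappa x)); rewrite -kappaM !mulVg kappa1.
have kappaP x : pres_val (kappa x) = pres_val x.
  apply: i_inj; rewrite psiP (push_sec push); last by exists 1; rewrite gmulf1.
  by rewrite etaP embP qv_eta embP p_i mulg1 (push_sec1 push) invg1 mulg1 mul1g.
have [C1 C1P] : exists C1, {in rels P0, forall r,
    nprod (any_conj (rels P)) C1 (psi (free_of_word r))}.
  apply: uniform_bound => [m n r lemn|r P0r]; first exact: nprod_leq.
  by apply/pres_valP; rewrite psiP pres_val_relator // /is_relator P0r.
have {}C1P s0 : any_conj (rels P0) s0 -> nprod (any_conj (rels P)) C1 (psi s0).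
  case=> u [r [_ P0r ->]]; rewrite !gmulfM gmulfV; apply: nprod_any_conjJ.
  move: r P0r; apply: (is_relator_ind (P := fun t => nprod _ C1 (psi t))) => // t.
  by rewrite gmulfV; apply: nprodV => t'; apply: rel_conjV.
have [C2 C2P] : exists C2, {in enum (gens P), forall y,
    nprod (any_conj (rels P)) C2 (free_gen y * (kappa (free_gen y))^-1)}.
  apply: uniform_bound => [m n y lemn|y _]; first exact: nprod_leq.
  by apply/pres_valP; rewrite gmulfM gmulfV /= kappaP mulgV.
have kappa_area w : nprod (any_conj (rels P)) (C2 * size w)
    (free_of_word w * (kappa (free_of_word w))^-1).
  elim: w => [|[y e] w IHw]; first by rewrite kappa1 mulgV; apply: nprod1.
  rewrite free_of_word_cons kappaM /= mulnS addnC; set a := if e then _ else _.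
  have -> : a * free_of_word w * (kappa a * kappa (free_of_word w))^-1 =
      (a * (free_of_word w * (kappa (free_of_word w))^-1) * a^-1) *
      (a * (kappa a)^-1).
    by rewrite invgM !mulgA mulgVK.
  apply: nprodM; first exact: nprod_any_conjJ.
  have yP := C2P y (mem_enum _ y); rewrite /a; case: e {a} => //.
  rewrite kappaV invgK.
  have -> : (free_gen y)^-1 * kappa (free_gen y) = (free_gen y)^-1 *
      (free_gen y * (kappa (free_gen y))^-1)^-1 * (free_gen y)^-1^-1.
    by rewrite invgM !invgK !mulgA mulgVK.
  by apply: nprod_any_conjJ; apply: nprodV yP => t; apply: rel_conjV.
pose blk (a : letter (gens P)) := if a.2 then inv_word (iota a.1) else iota a.1.
pose c0 := \max_y size (iota y).
have size_blk a : (size (blk a) <= c0)%N.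
  by rewrite /blk; case: a.2; rewrite ?size_inv_word; apply: leq_bigmax.
have blkP a : free_of_word (blk a) = emb (free_of_word [:: a]).
  rewrite free_of_letter /blk; case: a.2; rewrite ?gmulfV /= emb_gen //.
  by rewrite free_of_word_inv.
pose expand w := flatten [seq blk a | a <- w].
have expandP w : free_of_word (expand w) = emb (free_of_word w).
  elim: w => [|a w IHw]; first by rewrite gmulf1.
  by rewrite /= free_of_word_cat IHw blkP -gmulfM -free_of_word_cat.
have size_expand w : (size (expand w) <= c0 * size w)%N.
  elim: w => //= a w IHw; rewrite size_cat mulnS leq_add //.
(* Complete blocks die in [Q], so only the last, partial block of a prefix counts: the boundary
   stays within [c0] of 1. *)
have prefix w j : exists2 t : word (gens PG), (size t <= c0)%N &
    p (pres_val (free_of_word (take j (expand w)))) = p (pres_val (free_of_word t)).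
  elim: w j => [|a w IHw] j; first by exists [::].
  rewrite /expand /= take_cat; case: ltnP => lej.
    exists (take j (blk a)) => //; apply: leq_trans (size_blk a).
    by rewrite size_take; case: ltnP => // /ltnW.
  have [t st tE] := IHw (j - size (blk a))%N; exists t => //.
  by rewrite free_of_word_cat !gmulfM /= blkP embP p_i mul1g.
(* The summands serve the relators of the diagram, the passage from [w] to [kappa w], and the size
   of the expanded word. *)
pose C := (C1 * A.+1 ^ c0.+1 + C2 + c0)%N.
exists C => w w_null; exists (expand w); split=> [||D].
- rewrite /null_homotopic -pres_val_word expandP embP pres_val_word.
  by rewrite (w_null : word_val _ _ = _) gmulf1.
- by apply: leq_trans (size_expand w) _; rewrite leq_mul2r leq_addl orbT.
apply: area_leq; rewrite -[free_of_word w](mulgVK (kappa (free_of_word w))) addnC.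
apply: nprodM.
  apply: nprod_leq (kappa_area w).
  by rewrite leq_mul2r /C -addnA addnCA leq_addr orbT.
have := van_kampen (v := @pres_val G PG) (@pres_val_relator G PG) D.
rewrite expandP => nD.
have qv_conj U s0 : rel_conj (rels PG) U s0 -> qval p v (eta s0) = 1.
  case=> u [r [_ PGr ->]]; rewrite qv_eta !gmulfM /= pres_val_relator //.
  by rewrite gmulf1 mulg1 -!gmulfM mulgV !gmulf1.
have fD : nprod (any_conj (rels P0)) (vk_area D * A.+1 ^ (c0 + vk_radius D).+1)
    (f (emb (free_of_word w))).
  apply: nprod_map nD; first by rewrite /f gmulf1 (crossed1 PhiM).
    by move=> s0 y /qv_conj s0q; rewrite /f gmulfM PhiM /= s0q mulg1.
  move=> s0 s0D; have s0q := qv_conj _ _ s0D; case: s0D s0q.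
  move=> u [r [[j [w' [sw' uE]]] PGr ->]] _; rewrite /f !gmulfM gmulfV.
  rewrite (crossedJ PhiM) /=; last by rewrite qv_eta pres_val_relator // gmulf1.
  apply: nprod_any_conjJ; have [t st tE] := prefix w j.
  have -> : 1 * qval p v (eta u) =
      qval p v (free_of_word [seq (zx a.1, a.2) | a <- t ++ w']).
    rewrite mul1g qv_eta qv_word free_of_word_cat gmulfM /= gmulfM -tE.
    by rewrite uE gmulfM.
  apply: nprod_leq (AP r PGr _); rewrite size_map size_cat leq_pexp2l // ltnS.
  exact: leq_add.
apply: nprod_leq (nprod_morph C1P fD).
rewrite mulnC mulnA.
apply: (@leq_trans (C1 * A.+1 ^ c0.+1 * (A.+1 ^ vk_radius D * vk_area D))).
  rewrite -addSn expnD; apply: eq_leq.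
  by rewrite -!mulnA; congr (_ * _)%N; rewrite mulnC -mulnA.
by rewrite leq_mul2r /C -addnA leq_addr orbT.
Qed.

End Pushing.

(** * The bound on the Dehn function *)

Section GroupMorphism.
Variables (G H : groupType) (h : {multiplicative G -> H}).

(** A multiplicative map between groups preserves 1; this copy of [h] carries the unital structure
    used above. *)
Definition group_morphism : G -> H := h.

Lemma group_morphism1 : group_morphism 1 = 1.
Proof. by apply: (mulgI (h 1)); rewrite -gmulfM !mulg1. Qed.

HB.instance Definition _ := isUMagmaMorphism.Build G H group_morphism
  (group_morphism1, (gmulfM : {morph group_morphism : x y / x * y})).

End GroupMorphism.

Local Close Scope group_scope.
Local Open Scope ring_scope.

Theorem theorem1p2 (K : realType) (N G Q : groupType)
    (i : {multiplicative N -> G}) (p : {multiplicative G -> Q})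
    (Gfp : finitely_presented G)
    (NGQ_exact : short_exact i p)
    (Qfg : finitely_generated Q)
    (Qab : forall x y : Q, (x * y)%g = (y * x)%g)
    (Nfp : finitely_presented N)
    (f g : nat -> K)
    (fg_pair : area_radius_pair G f g)
    (f_ge : forall n : nat, n%:R <= f n) :
  exists2 A : K, 1 < A &
    forall P : finite_presentation N,
      asymp_le (fun n => (dehn P n)%:R) (fun n => A `^ g n * f n).
Proof.
case: NGQ_exact => i_inj exact_G _; case: Nfp => P0; case: fg_pair => PG fgP.
have [A AP] := area_pushdown (i := group_morphism i) (p := group_morphism p)
  i_inj exact_G Qab PG P0.
(* The base [A.+1] could be 1, so it is raised by one. *)
have A_gt1 : 1 < A.+2%:R :> K by rewrite ltr1n.
exists A.+2%:R => // P; have [C CP] := AP P.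
exists C.+1 => // n; set m := (C.+1 * n + C.+1)%N.
have f_ge0 : 0 <= f m by apply: le_trans (f_ge m); apply: ler0n.
(* The bound is checked for the value 0 of an empty maximum, for the maximum of two values, and for
   the area of a single word. *)
rewrite /dehn; elim/big_ind: _ => [|a b aP bP|w /asboolP w_null].
- by rewrite !addr_ge0 ?mulr_ge0 ?powR_ge0.
- by rewrite /maxn; case: ifP.
have [W [W_null sW WP]] := CP w w_null.
have sw : (size w <= n)%N by apply: size_bseq.
have [|D [areaD radiusD]] := fgP m W W_null.
  apply: leq_trans sW (leq_trans _ (leq_addr _ _)).
  by rewrite leq_mul.
apply: (@le_trans _ _ (C.+1 * (A.+2 ^ vk_radius D * vk_area D) + C.+1 * n)%:R).
  rewrite ler_nat; apply: leq_trans (WP D) _.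
  rewrite leq_add ?leq_mul //.
  (* Comparing powers through their bases requires a positive exponent, hence the case of radius
     0. *)
  by case: (vk_radius D) => [|r] //; rewrite leq_exp2r.
rewrite natrD !natrM natrX -[leLHS]addr0 lerD // lerD2r ler_wpM2l //.
rewrite -powR_mulrn //; apply: ler_pM => //; first exact: powR_ge0.
by apply: ler_powR => //; apply: ltW.
Qed.
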